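(* Let $C$ be a framed bicategory. If $C$ is fully faithful or absolutely dense, then $\ell C=1$. Moreover, if $C$ is fully faithful (respectively absolutely dense) and $\Phi$ is the $\pi_2$-opindexing (respectively $\pi_2$-indexing) on $H^*C$ induced by $C$, then there exists a unique strict double functor $$!:HC\rtimes_\Phi C_0\to C$$ such that $H^*!=\mathrm{id}_{H^*C}$. Moreover, $!$ is full on globularly generated squares of $C$.
   Context: **Double categories.** A double category $C$ has a category of objects and vertical morphisms $C_0$, a category of horizontal morphisms and squares $C_1$ (composition in $C_1$ is vertical composition of squares), left and right frame functors $L,R:C_1\to C_0$, a unit functor $U:C_0\to C_1$, and horizontal composition. Vertical composition is strict; horizontal composition may be associative and unital only up to coherent globular isomorphism. For squares, $\psi\circ\varphi$ denotes the vertical composite with $\varphi$ on top and $\psi$ below, and $\varphi*\psi$ denotes the horizontal composite. $U_a$ is the horizontal identity of an object $a$ and $U_f$ is the horizontal identity (unit) square of a vertical morphism $f$. A square is globular if its left and right frames are vertical identities. Objects, horizontal morphisms and globular squares of $C$ form a bicategory $HC$. $H^*C$ is the pair $(C_0,HC)$; for a strict double functor $F$, $H^*F$ denotes its restriction to vertical morphisms, horizontal morphisms and globular squares. $\pi_2(C,a)=\pi_2(HC,a)$ is the set of globular squares $U_a\Rightarrow U_a$; by Eckmann–Hilton it is a commutative monoid. **Framed bicategories.** A framed bicategory is a double category $C$ such that $L\times R:C_1\to C_0\times C_0$ is a bifibration; it is assumed throughout that $L\times R$ is a cloven and normal fibration (a choice of cartesian lifts is given, and the chosen lift along a pair of vertical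 identities is the identity square). A framed bicategory is fully faithful if $U_f$ is cartesian (for $L\times R$) for every vertical morphism $f$, and absolutely dense if $U_f$ is opcartesian for every vertical morphism $f$. **Globularly generated piece and length 1.** $\gamma C$ is the sub-double category of $C$ generated by the globular squares and the unit squares $U_f$ of $C$ (all squares obtained from these by vertical and horizontal composition). $\ell C=1$ means that every square of $\gamma C$ can be written as a vertical composite of finitely many squares, each of which is globular or a unit square $U_f$. ''Full on globularly generated squares of $C$'' means that every square of $\gamma C$ is the image of some square of the domain. **The induced $\Phi$.** If $C$ is fully faithful, the induced $\pi_2$-opindexing is the functor $\Phi:C_0^{op}\to\mathbf{commMon}$ (commutative monoids) with $\Phi(a)=\pi_2(C,a)$ and, for $f:a\to b$ and $\varphi\in\pi_2(C,b)$, $\Phi_f(\varphi)\in\pi_2(C,a)$ the unique square with $\varphi\circ U_f=U_f\circ\Phi_f(\varphi)$. If $C$ is absolutely dense, the induced $\pi_2$-indexing is the functor $\Phi:C_0\to\mathbf{commMon}$ with $\Phi(a)=\pi_2(C,a)$ and, for $f:a\to b$ and $\varphi\in\pi_2(C,a)$, $\Phi_f(\varphi)\in\pi_2(C,b)$ the unique square with $U_f\circ\varphi=\Phi_f(\varphi)\circ U_f$. **The double category $B\rtimes_\Phi B^*$** (used with $B=HC$, $B^*=C_0$). It satisfies $H^*(B\rtimes_\Phi B^* )=(B^*,B)$. Its vertical morphisms are those of $B^*$, its horizontal morphisms are the 1-cells of $B$, and its globular squares are the 2-cells of $B$ with the operations of $B$. Its other squares, for a non-identity morphism $f:a\to b$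 of $B^*$, are represented by triples $(\varphi_\downarrow,f,\varphi_\uparrow)$, where $\varphi_\uparrow:\alpha\Rightarrow \mathrm{id}_a$ and $\varphi_\downarrow:\mathrm{id}_b\Rightarrow\beta$ are 2-cells of $B$ for some 1-cells $\alpha:a\to a$, $\beta:b\to b$; such a square has left and right frames $f$, vertical domain $\alpha$ and vertical codomain $\beta$. Triples are taken modulo the equivalence relation generated by: in the opindexing case, $(\varphi_\downarrow\circ\psi,f,\varphi_\uparrow)\sim(\varphi_\downarrow,f,\Phi_f(\psi)\circ\varphi_\uparrow)$ for $\psi\in\pi_2(B,b)$; in the indexing case, $(\varphi_\downarrow,f,\psi\circ\varphi_\uparrow)\sim(\varphi_\downarrow\circ\Phi_f(\psi),f,\varphi_\uparrow)$ for $\psi\in\pi_2(B,a)$. A triple $(\varphi_\downarrow,\mathrm{id},\varphi_\uparrow)$ is identified with the 2-cell $\varphi_\downarrow\circ\varphi_\uparrow$. The unit square is $U_f=(\mathrm{id},f,\mathrm{id})$. Operations: - Horizontal composition: $(\varphi_\downarrow,f,\varphi_\uparrow)*(\psi_\downarrow,f,\psi_\uparrow)=(\varphi_\downarrow*\psi_\downarrow,f,\varphi_\uparrow*\psi_\uparrow)$, with unit isomorphisms $\mathrm{id}\,\mathrm{id}\cong\mathrm{id}$ of $B$ inserted where needed. - Vertical composition with globular squares: $\theta\circ(\varphi_\downarrow,f,\varphi_\uparrow)\circ\eta=(\theta\circ\varphi_\downarrow,f,\varphi_\uparrow\circ\eta)$. - Vertical composition of $(\varphi_\downarrow,f,\varphi_\uparrow)$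 (on top, $f:a\to b$) with $(\psi_\downarrow,g,\psi_\uparrow)$ (below, $g:b\to c$): $(\psi_\downarrow,gf,\Phi_f(\psi_\uparrow\circ\varphi_\downarrow)\circ\varphi_\uparrow)$ in the opindexing case, and $(\psi_\downarrow\circ\Phi_g(\psi_\uparrow\circ\varphi_\downarrow),gf,\varphi_\uparrow)$ in the indexing case. *)

(* Defs.v *)
From Stdlib Require Import ssreflect.
From Stdlib Require Import Relations ClassicalEpsilon ProofIrrelevance.
From Stdlib Require Import FunctionalExtensionality PropExtensionality Program.Equality.

Set Implicit Arguments.
Unset Strict Implicit.
Unset Printing Implicit Defensive.

Record CategoryOn (O : Type) := {
  Hom : O -> O -> Type;
  idm : forall a, Hom a a;
  comp : forall a b c, Hom b c -> Hom a b -> Hom a c;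
  comp_assoc : forall a b c d (h : Hom c d) (g : Hom b c) (f : Hom a b),
    comp h (comp g f) = comp (comp h g) f;
  comp_idl : forall a b (f : Hom a b), comp (idm b) f = f;
  comp_idr : forall a b (f : Hom a b), comp f (idm a) = f
}.

Arguments idm {O} _ a.

Declare Scope double_scope.
Open Scope double_scope.

Notation "g 'oV' f" := (comp g f) (at level 40, left associativity) : double_scope.

(** Horizontal composition is written in diagrammatic order throughout:
    [hcomp1 A B] is defined for [A] from [a] to [b] and [B] from [b] to [c]. *)
Record BicategoryOn (O : Type) := {
  cell1 : O -> O -> Type;
  cell2 : forall a b, cell1 a b -> cell1 a b -> Type;
  id2 : forall a b (A : cell1 a b), cell2 A A;
  comp2 : forall a b (A B D : cell1 a b), cell2 B D -> cell2 A B -> cell2 A D;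
  comp2_assoc : forall a b (A B D E : cell1 a b)
    (t : cell2 D E) (s : cell2 B D) (r : cell2 A B),
    comp2 t (comp2 s r) = comp2 (comp2 t s) r;
  comp2_idl : forall a b (A B : cell1 a b) (s : cell2 A B), comp2 (id2 B) s = s;
  comp2_idr : forall a b (A B : cell1 a b) (s : cell2 A B), comp2 s (id2 A) = s;
  id1 : forall a, cell1 a a;
  hcomp1 : forall a b c, cell1 a b -> cell1 b c -> cell1 a c;
  hcomp2 : forall a b c (A A' : cell1 a b) (B B' : cell1 b c),
    cell2 A A' -> cell2 B B' -> cell2 (hcomp1 A B) (hcomp1 A' B');
  hcomp2_id : forall a b c (A : cell1 a b) (B : cell1 b c),
    hcomp2 (id2 A) (id2 B) = id2 (hcomp1 A B);
  hcomp2_comp : forall a b c (A A' A'' : cell1 a b) (B B' B'' : cell1 b c)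
    (s' : cell2 A' A'') (s : cell2 A A') (t' : cell2 B' B'') (t : cell2 B B'),
    hcomp2 (comp2 s' s) (comp2 t' t) = comp2 (hcomp2 s' t') (hcomp2 s t);
  assoc2 : forall a b c d (A : cell1 a b) (B : cell1 b c) (D : cell1 c d),
    cell2 (hcomp1 (hcomp1 A B) D) (hcomp1 A (hcomp1 B D));
  assoc2_inv : forall a b c d (A : cell1 a b) (B : cell1 b c) (D : cell1 c d),
    cell2 (hcomp1 A (hcomp1 B D)) (hcomp1 (hcomp1 A B) D);
  assoc2K : forall a b c d (A : cell1 a b) (B : cell1 b c) (D : cell1 c d),
    comp2 (assoc2_inv A B D) (assoc2 A B D) = id2 _;
  assoc2VK : forall a b c d (A : cell1 a b) (B : cell1 b c) (D : cell1 c d),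
    comp2 (assoc2 A B D) (assoc2_inv A B D) = id2 _;
  assoc2_nat : forall a b c d (A A' : cell1 a b) (B B' : cell1 b c) (D D' : cell1 c d)
    (r : cell2 A A') (s : cell2 B B') (t : cell2 D D'),
    comp2 (assoc2 A' B' D') (hcomp2 (hcomp2 r s) t)
    = comp2 (hcomp2 r (hcomp2 s t)) (assoc2 A B D);
  lunit2 : forall a b (A : cell1 a b), cell2 (hcomp1 (id1 a) A) A;
  lunit2_inv : forall a b (A : cell1 a b), cell2 A (hcomp1 (id1 a) A);
  lunit2K : forall a b (A : cell1 a b), comp2 (lunit2_inv A) (lunit2 A) = id2 _;
  lunit2VK : forall a b (A : cell1 a b), comp2 (lunit2 A) (lunit2_inv A) = id2 _;
  lunit2_nat : forall a b (A A' : cell1 a b) (s : cell2 A A'),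
    comp2 (lunit2 A') (hcomp2 (id2 (id1 a)) s) = comp2 s (lunit2 A);
  runit2 : forall a b (A : cell1 a b), cell2 (hcomp1 A (id1 b)) A;
  runit2_inv : forall a b (A : cell1 a b), cell2 A (hcomp1 A (id1 b));
  runit2K : forall a b (A : cell1 a b), comp2 (runit2_inv A) (runit2 A) = id2 _;
  runit2VK : forall a b (A : cell1 a b), comp2 (runit2 A) (runit2_inv A) = id2 _;
  runit2_nat : forall a b (A A' : cell1 a b) (s : cell2 A A'),
    comp2 (runit2 A') (hcomp2 s (id2 (id1 b))) = comp2 s (runit2 A);
  pentagon2 : forall a b c d e
    (A : cell1 a b) (B : cell1 b c) (D : cell1 c d) (E : cell1 d e),
    comp2 (hcomp2 (id2 A) (assoc2 B D E))
      (comp2 (assoc2 A (hcomp1 B D) E) (hcomp2 (assoc2 A B D) (id2 E)))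
    = comp2 (assoc2 A B (hcomp1 D E)) (assoc2 (hcomp1 A B) D E);
  triangle2 : forall a b c (A : cell1 a b) (B : cell1 b c),
    comp2 (hcomp2 (id2 A) (lunit2 B)) (assoc2 A (id1 b) B)
    = hcomp2 (runit2 A) (id2 B)
}.

Arguments id1 {O} _ a.

Notation "t 'o2' s" := (comp2 t s) (at level 40, left associativity) : double_scope.
Notation "s *2 t" := (hcomp2 s t) (at level 38, left associativity) : double_scope.
Notation "A *1 B" := (hcomp1 A B) (at level 38, left associativity) : double_scope.

Section BicategoryTheory.
Variables (O : Type) (B : BicategoryOn O).

Lemma comp2_cancel_epi a b (A A' D : cell1 B a b) (u : cell2 A A') (v : cell2 A' A)
  (s t : cell2 A' D) : u o2 v = id2 _ -> s o2 u = t o2 u -> s = t.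
Proof.
move=> uv e; by rewrite -(comp2_idr s) -(comp2_idr t) -uv !comp2_assoc e.
Qed.

Lemma comp2_cancel_mono a b (A A' D : cell1 B a b) (u : cell2 A A') (v : cell2 A' A)
  (s t : cell2 D A) : v o2 u = id2 _ -> u o2 s = u o2 t -> s = t.
Proof.
move=> vu e; by rewrite -(comp2_idl s) -(comp2_idl t) -vu -!comp2_assoc e.
Qed.

Lemma whiskl_inj a b (A A' : cell1 B a b) (s t : cell2 A A') :
  id2 (id1 B a) *2 s = id2 (id1 B a) *2 t -> s = t.
Proof.
move=> e; apply: (comp2_cancel_epi (lunit2VK A)).
by rewrite -!lunit2_nat e.
Qed.

Lemma whiskr_inj a b (A A' : cell1 B a b) (s t : cell2 A A') :
  s *2 id2 (id1 B b) = t *2 id2 (id1 B b) -> s = t.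
Proof.
move=> e; apply: (comp2_cancel_epi (runit2VK A)).
by rewrite -!runit2_nat e.
Qed.

Lemma lunit2_hcomp a b c (A : cell1 B a b) (D : cell1 B b c) :
  lunit2 (A *1 D) o2 assoc2 (id1 B a) A D = lunit2 A *2 id2 D.
Proof.
apply: whiskl_inj.
have X1 : hcomp2 (assoc2_inv (id1 B a) (id1 B a) A) (id2 D)
          o2 assoc2_inv (id1 B a) (id1 B a *1 A) D
          o2 (assoc2 (id1 B a) (id1 B a *1 A) D
              o2 hcomp2 (assoc2 (id1 B a) (id1 B a) A) (id2 D)) = id2 _.
  rewrite comp2_assoc -(comp2_assoc _ _ (assoc2 _ _ D)) assoc2K comp2_idr.
  by rewrite -hcomp2_comp assoc2K comp2_idl hcomp2_id.
have X2 : (assoc2 (id1 B a) (id1 B a *1 A) D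
              o2 hcomp2 (assoc2 (id1 B a) (id1 B a) A) (id2 D)) o2
          (hcomp2 (assoc2_inv (id1 B a) (id1 B a) A) (id2 D)
          o2 assoc2_inv (id1 B a) (id1 B a *1 A) D) = id2 _.
  rewrite comp2_assoc -(comp2_assoc (assoc2 _ _ D)) -hcomp2_comp.
  by rewrite assoc2VK comp2_idl hcomp2_id comp2_idr assoc2VK.
apply: (comp2_cancel_epi X2).
rewrite -{1}(comp2_idl (id2 (id1 B a))) hcomp2_comp -!comp2_assoc pentagon2.
rewrite [in LHS]comp2_assoc triangle2 [in RHS]comp2_assoc -assoc2_nat -comp2_assoc -hcomp2_comp comp2_idl.
by rewrite triangle2 -hcomp2_id -assoc2_nat.
Qed.

Lemma lunit2_id1 a : lunit2 (id1 B a) = runit2 (id1 B a).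
Proof.
apply: whiskr_inj; rewrite -lunit2_hcomp -triangle2; congr (_ o2 _).
apply: (comp2_cancel_mono (lunit2K (id1 B a))).
by rewrite lunit2_nat.
Qed.

End BicategoryTheory.


Record DecoratedBicategory := {
  dob : Type;
  dver : CategoryOn dob;
  dbic : BicategoryOn dob
}.

(** The category [C_0] is [vcat]. The objects of [C_1] are the horizontal
    morphisms, presented as a family over their left and right objects, and its
    arrows are the squares: [sq A B] is the type of all squares with vertical
    domain [A] and vertical codomain [B], with arbitrary vertical frames, which
    are recovered by the functors [lfr] and [rfr]. In this way the vertical
    composition of squares is that of a strict category. The horizontal composite
    of two squares takes a proof that the frames along which they are
    glued agree. *)
Record DoubleCategory := {
  ob : Type;
  vcat : CategoryOn ob;
  hor : ob -> ob -> Type;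
  sq : forall a a' b b', hor a a' -> hor b b' -> Type;
  sqid : forall a a' (A : hor a a'), sq A A;
  vcomp : forall a a' b b' c c' (A : hor a a') (B : hor b b') (D : hor c c'),
    sq B D -> sq A B -> sq A D;
  vcomp_assoc : forall a a' b b' c c' d d'
    (A : hor a a') (B : hor b b') (D : hor c c') (E : hor d d')
    (r : sq D E) (q : sq B D) (p : sq A B),
    vcomp r (vcomp q p) = vcomp (vcomp r q) p;
  vcomp_idl : forall a a' b b' (A : hor a a') (B : hor b b') (p : sq A B),
    vcomp (sqid B) p = p;
  vcomp_idr : forall a a' b b' (A : hor a a') (B : hor b b') (p : sq A B),
    vcomp p (sqid A) = p;

  lfr : forall a a' b b' (A : hor a a') (B : hor b b'), sq A B -> Hom vcat a b;
  rfr : forall a a' b b' (A : hor a a') (B : hor b b'), sq A B -> Hom vcat a' b';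
  lfr_id : forall a a' (A : hor a a'), lfr (sqid A) = idm vcat a;
  rfr_id : forall a a' (A : hor a a'), rfr (sqid A) = idm vcat a';
  lfr_comp : forall a a' b b' c c' (A : hor a a') (B : hor b b') (D : hor c c')
    (q : sq B D) (p : sq A B), lfr (vcomp q p) = lfr q oV lfr p;
  rfr_comp : forall a a' b b' c c' (A : hor a a') (B : hor b b') (D : hor c c')
    (q : sq B D) (p : sq A B), rfr (vcomp q p) = rfr q oV rfr p;

  hid : forall a, hor a a;
  usq : forall a b, Hom vcat a b -> sq (hid a) (hid b);
  usq_id : forall a, usq (idm vcat a) = sqid (hid a);
  usq_comp : forall a b c (g : Hom vcat b c) (f : Hom vcat a b),
    usq (g oV f) = vcomp (usq g) (usq f);
  lfr_usq : forall a b (f : Hom vcat a b), lfr (usq f) = f;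
  rfr_usq : forall a b (f : Hom vcat a b), rfr (usq f) = f;

  hcomp : forall a b c, hor a b -> hor b c -> hor a c;
  hcomps : forall a a' a'' b b' b''
    (A : hor a a') (A' : hor a' a'') (B : hor b b') (B' : hor b' b'')
    (p : sq A B) (q : sq A' B'),
    rfr p = lfr q -> sq (hcomp A A') (hcomp B B');
  lfr_hcomps : forall a a' a'' b b' b''
    (A : hor a a') (A' : hor a' a'') (B : hor b b') (B' : hor b' b'')
    (p : sq A B) (q : sq A' B') (e : rfr p = lfr q),
    lfr (hcomps e) = lfr p;
  rfr_hcomps : forall a a' a'' b b' b''
    (A : hor a a') (A' : hor a' a'') (B : hor b b') (B' : hor b' b'')
    (p : sq A B) (q : sq A' B') (e : rfr p = lfr q),
    rfr (hcomps e) = rfr q;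
  hcomps_id : forall a b c (A : hor a b) (B : hor b c)
    (e : rfr (sqid A) = lfr (sqid B)),
    hcomps e = sqid (hcomp A B);
  interchange : forall a a' a'' b b' b'' c c' c''
    (A : hor a a') (A' : hor a' a'') (B : hor b b') (B' : hor b' b'')
    (D : hor c c') (D' : hor c' c'')
    (p : sq A B) (q : sq B D) (p' : sq A' B') (q' : sq B' D')
    (e : rfr (vcomp q p) = lfr (vcomp q' p'))
    (ep : rfr p = lfr p') (eq : rfr q = lfr q'),
    hcomps e = vcomp (hcomps eq) (hcomps ep);

  assoc : forall a b c d (A : hor a b) (B : hor b c) (D : hor c d),
    sq (hcomp (hcomp A B) D) (hcomp A (hcomp B D));
  assoc_inv : forall a b c d (A : hor a b) (B : hor b c) (D : hor c d),
    sq (hcomp A (hcomp B D)) (hcomp (hcomp A B) D);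
  lfr_assoc : forall a b c d (A : hor a b) (B : hor b c) (D : hor c d),
    lfr (assoc A B D) = idm vcat a;
  rfr_assoc : forall a b c d (A : hor a b) (B : hor b c) (D : hor c d),
    rfr (assoc A B D) = idm vcat d;
  assocK : forall a b c d (A : hor a b) (B : hor b c) (D : hor c d),
    vcomp (assoc_inv A B D) (assoc A B D) = sqid _;
  assocVK : forall a b c d (A : hor a b) (B : hor b c) (D : hor c d),
    vcomp (assoc A B D) (assoc_inv A B D) = sqid _;
  assoc_nat : forall a b c d a' b' c' d'
    (A : hor a b) (B : hor b c) (D : hor c d)
    (A' : hor a' b') (B' : hor b' c') (D' : hor c' d')
    (p : sq A A') (q : sq B B') (r : sq D D')
    (epq : rfr p = lfr q) (eqr : rfr q = lfr r)
    (epqr : rfr (hcomps epq) = lfr r) (epqr' : rfr p = lfr (hcomps eqr)),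
    vcomp (assoc A' B' D') (hcomps epqr) = vcomp (hcomps epqr') (assoc A B D);

  lunit : forall a b (A : hor a b), sq (hcomp (hid a) A) A;
  lunit_inv : forall a b (A : hor a b), sq A (hcomp (hid a) A);
  lfr_lunit : forall a b (A : hor a b), lfr (lunit A) = idm vcat a;
  rfr_lunit : forall a b (A : hor a b), rfr (lunit A) = idm vcat b;
  lunitK : forall a b (A : hor a b), vcomp (lunit_inv A) (lunit A) = sqid _;
  lunitVK : forall a b (A : hor a b), vcomp (lunit A) (lunit_inv A) = sqid _;
  lunit_nat : forall a a' b b' (A : hor a a') (B : hor b b') (p : sq A B)
    (e : rfr (usq (lfr p)) = lfr p),
    vcomp (lunit B) (hcomps e) = vcomp p (lunit A);

  runit : forall a b (A : hor a b), sq (hcomp A (hid b)) A;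
  runit_inv : forall a b (A : hor a b), sq A (hcomp A (hid b));
  lfr_runit : forall a b (A : hor a b), lfr (runit A) = idm vcat a;
  rfr_runit : forall a b (A : hor a b), rfr (runit A) = idm vcat b;
  runitK : forall a b (A : hor a b), vcomp (runit_inv A) (runit A) = sqid _;
  runitVK : forall a b (A : hor a b), vcomp (runit A) (runit_inv A) = sqid _;
  runit_nat : forall a a' b b' (A : hor a a') (B : hor b b') (p : sq A B)
    (e : rfr p = lfr (usq (rfr p))),
    vcomp (runit B) (hcomps e) = vcomp p (runit A);

  pentagon : forall a b c d e
    (A : hor a b) (B : hor b c) (D : hor c d) (E : hor d e)
    (e1 : rfr (sqid A) = lfr (assoc B D E))
    (e2 : rfr (assoc A B D) = lfr (sqid E)),
    vcomp (hcomps e1) (vcomp (assoc A (hcomp B D) E) (hcomps e2))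
    = vcomp (assoc A B (hcomp D E)) (assoc (hcomp A B) D E);
  triangle : forall a b c (A : hor a b) (B : hor b c)
    (e1 : rfr (sqid A) = lfr (lunit B)) (e2 : rfr (runit A) = lfr (sqid B)),
    vcomp (hcomps e1) (assoc A (hid b) B) = hcomps e2
}.

Arguments hid {_} a.
Arguments hcomps {_ a a' a'' b b' b'' A A' B B'} p q e.

Notation "q 'oS' p" := (vcomp q p) (at level 40, left associativity) : double_scope.
Notation "A ** B" := (hcomp A B) (at level 38, left associativity) : double_scope.

Definition globular (C : DoubleCategory) (a a' : ob C) (A B : hor a a') (p : sq A B) : Prop :=
  lfr p = idm (vcat C) a /\ rfr p = idm (vcat C) a'.

(** Total spaces, used to compare vertical morphisms, horizontal morphisms and
    squares whose boundaries are only propositionally equal. *)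
Record VMor (C : DoubleCategory) := MkVMor {
  vm_src : ob C; vm_tgt : ob C; vm : Hom (vcat C) vm_src vm_tgt }.

Record HMor (C : DoubleCategory) := MkHMor {
  hm_src : ob C; hm_tgt : ob C; hm : hor hm_src hm_tgt }.

Record Square (C : DoubleCategory) := MkSquare {
  sq_a : ob C; sq_a' : ob C; sq_b : ob C; sq_b' : ob C;
  sq_top : hor sq_a sq_a'; sq_bot : hor sq_b sq_b';
  sq_sq : sq sq_top sq_bot }.

Section HorizontalBicategory.
Variable C : DoubleCategory.

Definition glob_cell (a a' : ob C) (A B : hor a a') : Type :=
  { p : sq A B | globular p }.

Lemma glob_cell_eq (a a' : ob C) (A B : hor a a') (s t : glob_cell A B) :
  proj1_sig s = proj1_sig t -> s = t.
Proof.
case: s => s hs; case: t => t ht /= e; subst t.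
by congr (exist _ s _); apply: proof_irrelevance.
Qed.

Lemma hcomps_irr (a a' a'' b b' b'' : ob C)
    (A : hor a a') (A' : hor a' a'') (B : hor b b') (B' : hor b' b'')
    (p p' : sq A B) (q q' : sq A' B') e e' :
  p = p' -> q = q' -> hcomps p q e = hcomps p' q' e'.
Proof.
move=> ep eq; subst p' q'; congr (hcomps p q _); exact: proof_irrelevance.
Qed.

Lemma globular_id (a a' : ob C) (A : hor a a') : globular (sqid A).
Proof. by split; rewrite ?lfr_id ?rfr_id. Qed.

Lemma globular_comp (a a' : ob C) (A B D : hor a a') (q : sq B D) (p : sq A B) :
  globular q -> globular p -> globular (q oS p).
Proof.
by move=> [ql qr] [pl pr]; split; rewrite ?lfr_comp ?rfr_comp ?ql ?qr ?pl ?pr comp_idl.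
Qed.

Lemma globular_inv (a a' : ob C) (A B : hor a a') (q : sq B A) (p : sq A B) :
  q oS p = sqid A -> globular p -> globular q.
Proof.
move=> e [pl pr]; split.
- by rewrite -(comp_idr (lfr q)) -pl -lfr_comp e lfr_id.
- by rewrite -(comp_idr (rfr q)) -pr -rfr_comp e rfr_id.
Qed.

Lemma glob_frames (a b c : ob C) (A B : hor a b) (A' B' : hor b c)
  (p : sq A B) (q : sq A' B') : globular p -> globular q -> rfr p = lfr q.
Proof. by move=> [_ ->] [-> _]. Qed.

Lemma globular_hcomps (a b c : ob C) (A B : hor a b) (A' B' : hor b c)
  (p : sq A B) (q : sq A' B') (hp : globular p) (hq : globular q) e :
  globular (hcomps p q e).
Proof.
by split; rewrite ?lfr_hcomps ?rfr_hcomps; [case: hp|case: hq].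
Qed.

Definition HC_hcomp2 (a b c : ob C) (A A' : hor a b) (B B' : hor b c)
    (s : glob_cell A A') (t : glob_cell B B') : glob_cell (A ** B) (A' ** B') :=
  exist _ (hcomps (proj1_sig s) (proj1_sig t)
             (glob_frames (proj2_sig s) (proj2_sig t)))
    (globular_hcomps (proj2_sig s) (proj2_sig t) _).

Definition HC_comp2 (a b : ob C) (A B D : hor a b)
    (t : glob_cell B D) (s : glob_cell A B) : glob_cell A D :=
  exist _ (proj1_sig t oS proj1_sig s) (globular_comp (proj2_sig t) (proj2_sig s)).

Definition HC_id2 (a b : ob C) (A : hor a b) : glob_cell A A :=
  exist _ (sqid A) (globular_id A).

Definition HC_lunit2 (a b : ob C) (A : hor a b) : glob_cell (hid a ** A) A :=
  exist _ (lunit A) (conj (lfr_lunit A) (rfr_lunit A)).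

Definition HC_runit2 (a b : ob C) (A : hor a b) : glob_cell (A ** hid b) A :=
  exist _ (runit A) (conj (lfr_runit A) (rfr_runit A)).

Lemma HC_lunit_nat (a b : ob C) (A A' : hor a b) (s : glob_cell A A') :
  HC_comp2 (HC_lunit2 A') (HC_hcomp2 (HC_id2 (hid a)) s) = HC_comp2 s (HC_lunit2 A).
Proof.
apply: glob_cell_eq => /=.
have e : rfr (usq (lfr (proj1_sig s))) = lfr (proj1_sig s) by rewrite rfr_usq.
rewrite -(lunit_nat e); congr (_ oS _); apply: hcomps_irr => //.
by rewrite (proj1 (proj2_sig s)) usq_id.
Qed.

Lemma HC_runit_nat (a b : ob C) (A A' : hor a b) (s : glob_cell A A') :
  HC_comp2 (HC_runit2 A') (HC_hcomp2 s (HC_id2 (hid b))) = HC_comp2 s (HC_runit2 A).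
Proof.
apply: glob_cell_eq => /=.
have e : rfr (proj1_sig s) = lfr (usq (rfr (proj1_sig s))) by rewrite lfr_usq.
rewrite -(runit_nat e); congr (_ oS _); apply: hcomps_irr => //.
by rewrite (proj2 (proj2_sig s)) usq_id.
Qed.

Definition HC : BicategoryOn (ob C).
Proof.
unshelve refine {|
  cell1 := @hor C;
  cell2 := glob_cell;
  id2 := HC_id2;
  comp2 := HC_comp2;
  id1 := @hid C;
  hcomp1 := @hcomp C;
  hcomp2 := HC_hcomp2;
  assoc2 := fun a b c d A B D => exist _ (assoc A B D)
              (conj (lfr_assoc A B D) (rfr_assoc A B D));
  assoc2_inv := fun a b c d A B D => exist _ (assoc_inv A B D)
              (globular_inv (assocK A B D) (conj (lfr_assoc A B D) (rfr_assoc A B D)));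
  lunit2 := HC_lunit2;
  lunit2_inv := fun a b A => exist _ (lunit_inv A)
              (globular_inv (lunitK A) (conj (lfr_lunit A) (rfr_lunit A)));
  runit2 := HC_runit2;
  runit2_inv := fun a b A => exist _ (runit_inv A)
              (globular_inv (runitK A) (conj (lfr_runit A) (rfr_runit A)))
|}.
- abstract (intros; apply: glob_cell_eq; exact: vcomp_assoc).
- abstract (intros; apply: glob_cell_eq; exact: vcomp_idl).
- abstract (intros; apply: glob_cell_eq; exact: vcomp_idr).
- abstract (intros; apply: glob_cell_eq; exact: hcomps_id).
- abstract (intros; apply: glob_cell_eq; exact: interchange).
- abstract (intros; apply: glob_cell_eq; exact: assocK).
- abstract (intros; apply: glob_cell_eq; exact: assocVK).
- abstract (intros; apply: glob_cell_eq; exact: assoc_nat).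
- abstract (intros; apply: glob_cell_eq; exact: lunitK).
- abstract (intros; apply: glob_cell_eq; exact: lunitVK).
- exact: HC_lunit_nat.
- abstract (intros; apply: glob_cell_eq; exact: runitK).
- abstract (intros; apply: glob_cell_eq; exact: runitVK).
- exact: HC_runit_nat.
- abstract (intros; apply: glob_cell_eq; exact: pentagon).
- abstract (intros; apply: glob_cell_eq; exact: triangle).
Defined.

End HorizontalBicategory.

Definition Hstar (C : DoubleCategory) : DecoratedBicategory :=
  {| dob := ob C; dver := vcat C; dbic := HC C |}.

Record StrictDoubleFunctor (D C : DoubleCategory) := {
  fob : ob D -> ob C;
  fver : forall a b, Hom (vcat D) a b -> Hom (vcat C) (fob a) (fob b);
  fhor : forall a b, hor a b -> hor (fob a) (fob b);
  fsq : forall a a' b b' (A : hor a a') (B : hor b b'), sq A B -> sq (fhor A) (fhor B);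
  fver_id : forall a, fver (idm (vcat D) a) = idm (vcat C) (fob a);
  fver_comp : forall a b c (g : Hom (vcat D) b c) (f : Hom (vcat D) a b),
    fver (g oV f) = fver g oV fver f;
  fsq_id : forall a a' (A : hor a a'), fsq (sqid A) = sqid (fhor A);
  fsq_comp : forall a a' b b' c c' (A : hor a a') (B : hor b b') (E : hor c c')
    (q : sq B E) (p : sq A B), fsq (q oS p) = fsq q oS fsq p;
  fsq_lfr : forall a a' b b' (A : hor a a') (B : hor b b') (p : sq A B),
    lfr (fsq p) = fver (lfr p);
  fsq_rfr : forall a a' b b' (A : hor a a') (B : hor b b') (p : sq A B),
    rfr (fsq p) = fver (rfr p);
  fhor_hid : forall a, fhor (hid a) = hid (fob a);
  fsq_usq : forall a b (f : Hom (vcat D) a b),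
    MkSquare (fsq (usq f)) = MkSquare (usq (fver f));
  fhor_hcomp : forall a b c (A : hor a b) (B : hor b c),
    fhor (A ** B) = fhor A ** fhor B;
  fsq_hcomps : forall a a' a'' b b' b''
    (A : hor a a') (A' : hor a' a'') (B : hor b b') (B' : hor b' b'')
    (p : sq A B) (q : sq A' B')
    (e : rfr p = lfr q) (e' : rfr (fsq p) = lfr (fsq q)),
    MkSquare (fsq (hcomps p q e)) = MkSquare (hcomps (fsq p) (fsq q) e');
  fsq_assoc : forall a b c d (A : hor a b) (B : hor b c) (E : hor c d),
    MkSquare (fsq (assoc A B E)) = MkSquare (assoc (fhor A) (fhor B) (fhor E));
  fsq_lunit : forall a b (A : hor a b), MkSquare (fsq (lunit A)) = MkSquare (lunit (fhor A));
  fsq_runit : forall a b (A : hor a b), MkSquare (fsq (runit A)) = MkSquare (runit (fhor A))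
}.

Section Framed.
Variable C : DoubleCategory.

(** Cartesian and opcartesian arrows for [L x R : C_1 -> C_0 x C_0]. *)
Definition cartesian (a a' b b' : ob C) (A : hor a a') (B : hor b b') (p : sq A B) : Prop :=
  forall (c c' : ob C) (D : hor c c') (q : sq D B)
    (u : Hom (vcat C) c a) (v : Hom (vcat C) c' a'),
    lfr q = lfr p oV u -> rfr q = rfr p oV v ->
    exists! r : sq D A, lfr r = u /\ rfr r = v /\ p oS r = q.

Definition opcartesian (a a' b b' : ob C) (A : hor a a') (B : hor b b') (p : sq A B) : Prop :=
  forall (c c' : ob C) (D : hor c c') (q : sq A D)
    (u : Hom (vcat C) b c) (v : Hom (vcat C) b' c'),
    lfr q = u oV lfr p -> rfr q = v oV rfr p ->
    exists! r : sq B D, lfr r = u /\ rfr r = v /\ r oS p = q.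

Definition fully_faithful : Prop :=
  forall (a b : ob C) (f : Hom (vcat C) a b), cartesian (usq f).

Definition absolutely_dense : Prop :=
  forall (a b : ob C) (f : Hom (vcat C) a b), opcartesian (usq f).

(** The squares of [gamma C]. All objects, vertical and horizontal morphisms of [C]
    belong to [gamma C]. *)
Inductive globularly_generated :
  forall (a a' b b' : ob C) (A : hor a a') (B : hor b b'), sq A B -> Prop :=
| gg_glob a a' (A B : hor a a') (p : sq A B) :
    globular p -> globularly_generated p
| gg_unit a b (f : Hom (vcat C) a b) : globularly_generated (usq f)
| gg_vcomp a a' b b' c c' (A : hor a a') (B : hor b b') (D : hor c c')
    (q : sq B D) (p : sq A B) :
    globularly_generated q -> globularly_generated p -> globularly_generated (q oS p)
| gg_hcomps a a' a'' b b' b''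
    (A : hor a a') (A' : hor a' a'') (B : hor b b') (B' : hor b' b'')
    (p : sq A B) (q : sq A' B') (e : rfr p = lfr q) :
    globularly_generated p -> globularly_generated q ->
    globularly_generated (hcomps p q e).

Inductive vertically_generated :
  forall (a a' b b' : ob C) (A : hor a a') (B : hor b b'), sq A B -> Prop :=
| vg_glob a a' (A B : hor a a') (p : sq A B) :
    globular p -> vertically_generated p
| vg_unit a b (f : Hom (vcat C) a b) : vertically_generated (usq f)
| vg_vcomp a a' b b' c c' (A : hor a a') (B : hor b b') (D : hor c c')
    (q : sq B D) (p : sq A B) :
    vertically_generated q -> vertically_generated p -> vertically_generated (q oS p).

(** [length_one] is [l C = 1]. *)
Definition length_one : Prop :=
  forall (a a' b b' : ob C) (A : hor a a') (B : hor b b') (p : sq A B),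
    globularly_generated p -> vertically_generated p.

End Framed.

(** [L x R] is a cloven normal fibration and an opfibration. *)
Record FramedBicategory := {
  fdc :> DoubleCategory;
  lift_dom : forall (a a' b b' : ob fdc),
    Hom (vcat fdc) a b -> Hom (vcat fdc) a' b' -> hor b b' -> hor a a';
  lift : forall (a a' b b' : ob fdc)
    (f : Hom (vcat fdc) a b) (g : Hom (vcat fdc) a' b') (B : hor b b'),
    sq (lift_dom f g B) B;
  lfr_lift : forall (a a' b b' : ob fdc)
    (f : Hom (vcat fdc) a b) (g : Hom (vcat fdc) a' b') (B : hor b b'),
    lfr (lift f g B) = f;
  rfr_lift : forall (a a' b b' : ob fdc)
    (f : Hom (vcat fdc) a b) (g : Hom (vcat fdc) a' b') (B : hor b b'),
    rfr (lift f g B) = g;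
  lift_cartesian : forall (a a' b b' : ob fdc)
    (f : Hom (vcat fdc) a b) (g : Hom (vcat fdc) a' b') (B : hor b b'),
    cartesian (lift f g B);
  lift_normal : forall (b b' : ob fdc) (B : hor b b'),
    MkSquare (lift (idm (vcat fdc) b) (idm (vcat fdc) b') B) = MkSquare (sqid B);
  oplift : forall (a a' b b' : ob fdc)
    (f : Hom (vcat fdc) a b) (g : Hom (vcat fdc) a' b') (A : hor a a'),
    exists (B : hor b b') (p : sq A B), lfr p = f /\ rfr p = g /\ opcartesian p
}.

Definition pi2 (X : DecoratedBicategory) (a : dob X) : Type :=
  cell2 (id1 (dbic X) a) (id1 (dbic X) a).

Arguments pi2 X a : clear implicits.

(** Functors [B^*op -> commMon] and [B^* -> commMon] which on objects are [pi2];
    the monoid [pi2 X a] is commutative by [pi2_comm] below. *)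
Record Opindexing (X : DecoratedBicategory) := {
  op_map : forall a b : dob X, Hom (dver X) a b -> pi2 X b -> pi2 X a;
  op_one : forall a b (f : Hom (dver X) a b), op_map f (id2 _) = id2 _;
  op_mul : forall a b (f : Hom (dver X) a b) (y x : pi2 X b),
    op_map f (y o2 x) = op_map f y o2 op_map f x;
  op_idm : forall a (x : pi2 X a), op_map (idm (dver X) a) x = x;
  op_comp : forall a b c (g : Hom (dver X) b c) (f : Hom (dver X) a b) (x : pi2 X c),
    op_map (g oV f) x = op_map f (op_map g x)
}.

Record Indexing (X : DecoratedBicategory) := {
  ix_map : forall a b : dob X, Hom (dver X) a b -> pi2 X a -> pi2 X b;
  ix_one : forall a b (f : Hom (dver X) a b), ix_map f (id2 _) = id2 _;
  ix_mul : forall a b (f : Hom (dver X) a b) (y x : pi2 X a),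
    ix_map f (y o2 x) = ix_map f y o2 ix_map f x;
  ix_idm : forall a (x : pi2 X a), ix_map (idm (dver X) a) x = x;
  ix_comp : forall a b c (g : Hom (dver X) b c) (f : Hom (dver X) a b) (x : pi2 X a),
    ix_map (g oV f) x = ix_map g (ix_map f x)
}.

Variant PiIndexing (X : DecoratedBicategory) :=
| OpInd (P : Opindexing X)
| Ind (P : Indexing X).

Section Pi2Theory.
Variable X : DecoratedBicategory.
Local Notation I a := (id1 (dbic X) a).

Lemma lunit_hcomp2 (a : dob X) (y x : pi2 X a) :
  lunit2 (I a) o2 (y *2 x) = y o2 x o2 lunit2 (I a).
Proof.
rewrite -{1}(comp2_idr y) -{1}(comp2_idl x) hcomp2_comp comp2_assoc.
by rewrite {1}lunit2_id1 runit2_nat -lunit2_id1 -!comp2_assoc lunit2_nat.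
Qed.

Lemma hcomp2_lunit_inv (a : dob X) (y x : pi2 X a) :
  (y *2 x) o2 lunit2_inv (I a) = lunit2_inv (I a) o2 (y o2 x).
Proof.
apply: (comp2_cancel_mono (lunit2K (I a))).
by rewrite !comp2_assoc lunit_hcomp2 lunit2VK comp2_idl -!comp2_assoc lunit2VK comp2_idr.
Qed.

Lemma pi2_comm (a : dob X) (y x : pi2 X a) : y o2 x = x o2 y.
Proof.
have e : (id2 _ o2 y) *2 (x o2 id2 _) = (y o2 id2 _) *2 (id2 (I a) o2 x).
  by rewrite !comp2_idl !comp2_idr.
apply: (comp2_cancel_epi (lunit2VK (I a))).
rewrite -lunit_hcomp2 -{1}(comp2_idl y) -{1}(comp2_idr x) hcomp2_comp.
by rewrite comp2_assoc !lunit_hcomp2 comp2_idl -comp2_assoc lunit_hcomp2 comp2_idr comp2_assoc.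
Qed.
End Pi2Theory.

Section Choice.
Variables (T : Type) (P : T -> Prop) (h : exists x, P x).
Definition the : T := proj1_sig (constructive_indefinite_description P h).
Lemma theP : P the.
Proof. exact: proj2_sig. Qed.
End Choice.

(** The set of classes of the equivalence relation generated by [R]. *)
Section Quotient.
Variables (T : Type) (R : T -> T -> Prop).

Definition quot : Type :=
  { P : T -> Prop | exists x, P = clos_refl_sym_trans T R x }.

Definition cls (x : T) : quot :=
  exist _ (clos_refl_sym_trans T R x) (ex_intro _ x eq_refl).

Lemma cls_eq x y : clos_refl_sym_trans T R x y -> cls x = cls y.
Proof.
move=> h; have e : clos_refl_sym_trans T R x = clos_refl_sym_trans T R y.
  apply: functional_extensionality => z; apply: propositional_extensionality.
  by split=> h'; apply: rst_trans h'; [apply: rst_sym|].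
rewrite /cls; move: (ex_intro _ x _) (ex_intro _ y _); rewrite e => p q.
by congr exist; apply: proof_irrelevance.
Qed.

Lemma cls_inj x y : cls x = cls y -> clos_refl_sym_trans T R x y.
Proof.
move=> /(f_equal (@proj1_sig _ _)) /= ->; exact: rst_refl.
Qed.

Lemma cls_surj (q : quot) : exists x, q = cls x.
Proof.
case: q => P [x e]; exists x; subst P.
by congr exist; apply: proof_irrelevance.
Qed.
End Quotient.

Section Crossed.
Variables (X : DecoratedBicategory) (Phi : PiIndexing X).
Local Notation O := (dob X).
Local Notation V := (dver X).
Local Notation B := (dbic X).

(** Representatives of squares: 2-cells of [B], and triples
    [(phi_down, f, phi_up)]. Triples are also formed for identity morphisms, and
    are identified with 2-cells by [rel_id]. *)
Inductive presq : forall a a' b b' : O, cell1 B a a' -> cell1 B b b' -> Type :=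
| pglob a a' (A A' : cell1 B a a') (t : cell2 A A') : presq A A'
| ptri a b (A : cell1 B a a) (D : cell1 B b b)
    (dn : cell2 (id1 B b) D) (f : Hom V a b) (up : cell2 A (id1 B a)) : presq A D.

Definition plfr a a' b b' (A : cell1 B a a') (D : cell1 B b b') (x : presq A D) : Hom V a b :=
  match x with
  | @pglob a _ _ _ _ => idm V a
  | @ptri _ _ _ _ _ f _ => f
  end.

Definition prfr a a' b b' (A : cell1 B a a') (D : cell1 B b b') (x : presq A D) : Hom V a' b' :=
  match x with
  | @pglob _ a' _ _ _ => idm V a'
  | @ptri _ _ _ _ _ f _ => f
  end.

(** [slide f y x] stands for the relation [y o U_f = U_f o x]. *)
Definition slide a b (f : Hom V a b) (y : pi2 X b) (x : pi2 X a) : Prop :=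
  match Phi with
  | OpInd P => x = op_map P f y
  | Ind P => y = ix_map P f x
  end.

Inductive rel : forall a a' b b' (A : cell1 B a a') (D : cell1 B b b'),
    presq A D -> presq A D -> Prop :=
| rel_slide a b (A : cell1 B a a) (D : cell1 B b b)
    (dn : cell2 (id1 B b) D) (f : Hom V a b) (up : cell2 A (id1 B a))
    (y : pi2 X b) (x : pi2 X a) :
    slide f y x -> rel (ptri (dn o2 y) f up) (ptri dn f (x o2 up))
| rel_id a (A D : cell1 B a a) (dn : cell2 (id1 B a) D) (up : cell2 A (id1 B a)) :
    rel (ptri dn (idm V a) up) (pglob (dn o2 up)).

Definition csq a a' b b' (A : cell1 B a a') (D : cell1 B b b') : Type :=
  quot (@rel a a' b b' A D).

Definition Glob a a' (A A' : cell1 B a a') (t : cell2 A A') : csq A A' :=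
  cls _ (pglob t).

Definition Tri a b (A : cell1 B a a) (D : cell1 B b b)
    (dn : cell2 (id1 B b) D) (f : Hom V a b) (up : cell2 A (id1 B a)) : csq A D :=
  cls _ (ptri dn f up).

(** The operations are first given as relations between representatives:
    [pvcomp x y z] means that [z] represents [y o x]. *)
Definition ptri_comp a b c (A : cell1 B a a) (D : cell1 B c c)
    (dn : cell2 (id1 B c) D) (g : Hom V b c) (m : pi2 X b) (f : Hom V a b)
    (up : cell2 A (id1 B a)) : presq A D :=
  match Phi with
  | OpInd P => ptri dn (g oV f) (op_map P f m o2 up)
  | Ind P => ptri (dn o2 ix_map P g m) (g oV f) up
  end.

Inductive pvcomp : forall a a' b b' c c'
    (A : cell1 B a a') (D : cell1 B b b') (E : cell1 B c c'),
    presq A D -> presq D E -> presq A E -> Prop :=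
| pv_gg a a' (A D E : cell1 B a a') (s : cell2 A D) (t : cell2 D E) :
    pvcomp (pglob s) (pglob t) (pglob (t o2 s))
| pv_gt a b (A A' : cell1 B a a) (D : cell1 B b b) (s : cell2 A A')
    (dn : cell2 (id1 B b) D) (f : Hom V a b) (up : cell2 A' (id1 B a)) :
    pvcomp (pglob s) (ptri dn f up) (ptri dn f (up o2 s))
| pv_tg a b (A : cell1 B a a) (D D' : cell1 B b b) (t : cell2 D D')
    (dn : cell2 (id1 B b) D) (f : Hom V a b) (up : cell2 A (id1 B a)) :
    pvcomp (ptri dn f up) (pglob t) (ptri (t o2 dn) f up)
| pv_tt a b c (A : cell1 B a a) (D : cell1 B b b) (E : cell1 B c c)
    (dn : cell2 (id1 B b) D) (f : Hom V a b) (up : cell2 A (id1 B a))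
    (dn' : cell2 (id1 B c) E) (g : Hom V b c) (up' : cell2 D (id1 B b)) :
    pvcomp (ptri dn f up) (ptri dn' g up') (ptri_comp dn' g (up' o2 dn) f up).

Inductive phcomp : forall a a' a'' b b' b''
    (A : cell1 B a a') (A' : cell1 B a' a'') (D : cell1 B b b') (D' : cell1 B b' b''),
    presq A D -> presq A' D' -> presq (A *1 A') (D *1 D') -> Prop :=
| ph_gg a a' a'' (A D : cell1 B a a') (A' D' : cell1 B a' a'')
    (s : cell2 A D) (t : cell2 A' D') :
    phcomp (pglob s) (pglob t) (pglob (s *2 t))
| ph_tt a b (A A' : cell1 B a a) (D D' : cell1 B b b) (f : Hom V a b)
    (dn : cell2 (id1 B b) D) (up : cell2 A (id1 B a))
    (dn' : cell2 (id1 B b) D') (up' : cell2 A' (id1 B a)) :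
    phcomp (ptri dn f up) (ptri dn' f up')
      (ptri ((dn *2 dn') o2 lunit2_inv (id1 B b)) f
            (lunit2 (id1 B a) o2 (up *2 up'))).

Lemma csq_case a a' b b' (A : cell1 B a a') (D : cell1 B b b') (p : csq A D) :
  exists x, p = cls _ x.
Proof. exact: cls_surj. Qed.

Definition clfr a a' b b' (A : cell1 B a a') (D : cell1 B b b') (p : csq A D) : Hom V a b :=
  plfr (the (csq_case p)).

Definition crfr a a' b b' (A : cell1 B a a') (D : cell1 B b b') (p : csq A D) : Hom V a' b' :=
  prfr (the (csq_case p)).

Lemma frames_inv a a' b b' (A : cell1 B a a') (D : cell1 B b b') (x y : presq A D) :
  clos_refl_sym_trans _ (@rel _ _ _ _ A D) x y -> plfr x = plfr y /\ prfr x = prfr y.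
Proof.
elim=> {x y}.
- by move=> x y [].
- by [].
- by move=> x y _ [-> ->].
- by move=> x y z _ [-> ->] _ [-> ->].
Qed.

Lemma clfr_cls a a' b b' (A : cell1 B a a') (D : cell1 B b b') (x : presq A D) :
  clfr (cls _ x) = plfr x.
Proof.
by rewrite /clfr; case: (frames_inv (cls_inj (theP (csq_case (cls _ x))))).
Qed.

Lemma crfr_cls a a' b b' (A : cell1 B a a') (D : cell1 B b b') (x : presq A D) :
  crfr (cls _ x) = prfr x.
Proof.
by rewrite /crfr; case: (frames_inv (cls_inj (theP (csq_case (cls _ x))))).
Qed.

Lemma Tri_slide a b (A : cell1 B a a) (D : cell1 B b b)
    (dn : cell2 (id1 B b) D) (f : Hom V a b) (up : cell2 A (id1 B a)) y x :
  slide f y x -> Tri (dn o2 y) f up = Tri dn f (x o2 up).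
Proof. by move=> h; apply: cls_eq; apply: rst_step; constructor. Qed.

Lemma Tri_id a (A D : cell1 B a a) (dn : cell2 (id1 B a) D) (up : cell2 A (id1 B a)) :
  Tri dn (idm V a) up = Glob (dn o2 up).
Proof. by apply: cls_eq; apply: rst_step; constructor. Qed.

Lemma pvcomp_fun a a' b b' c c'
    (A : cell1 B a a') (D : cell1 B b b') (E : cell1 B c c')
    (x : presq A D) (y : presq D E) z z' :
  pvcomp x y z -> pvcomp x y z' -> z = z'.
Proof.
by move=> h; move: z'; destruct h => z' h'; dependent destruction h'.
Qed.

Lemma pvcomp_ex a a' b b' c c'
    (A : cell1 B a a') (D : cell1 B b b') (E : cell1 B c c')
    (x : presq A D) (y : presq D E) : exists z, pvcomp x y z.
Proof.
dependent destruction x; dependent destruction y; eexists; by constructor.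
Qed.

Lemma Tri_comp_slide_top a b c (A : cell1 B a a) (D : cell1 B b b) (E : cell1 B c c)
    (dn : cell2 (id1 B b) D) (f : Hom V a b) (up : cell2 A (id1 B a)) y x
    (dn' : cell2 (id1 B c) E) (g : Hom V b c) (up' : cell2 D (id1 B b)) :
  slide f y x ->
  cls (@rel _ _ _ _ A E) (ptri_comp dn' g (up' o2 (dn o2 y)) f up) =
  cls _ (ptri_comp dn' g (up' o2 dn) f (x o2 up)).
Proof.
rewrite /slide /ptri_comp; case ePhi: Phi => [P|P] e.
- by rewrite e (comp2_assoc up') op_mul comp2_assoc.
- rewrite e (comp2_assoc up') ix_mul -ix_comp comp2_assoc.
  by apply: Tri_slide; rewrite /slide ePhi.
Qed.

Lemma Tri_comp_id_top b c (D A : cell1 B b b) (E : cell1 B c c)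
    (dn : cell2 (id1 B b) D) (up : cell2 A (id1 B b))
    (dn' : cell2 (id1 B c) E) (g : Hom V b c) (up' : cell2 D (id1 B b)) :
  cls (@rel _ _ _ _ A E) (ptri_comp dn' g (up' o2 dn) (idm V b) up) =
  Tri dn' g (up' o2 (dn o2 up)).
Proof.
rewrite /ptri_comp; case ePhi: Phi => [P|P].
- by rewrite op_idm comp_idr comp2_assoc.
- by rewrite comp_idr comp2_assoc; apply: Tri_slide; rewrite /slide ePhi.
Qed.

Lemma Tri_comp_slide_bot a b c (A : cell1 B a a) (D : cell1 B b b) (E : cell1 B c c)
    (dn : cell2 (id1 B b) D) (f : Hom V a b) (up : cell2 A (id1 B a))
    (dn' : cell2 (id1 B c) E) (g : Hom V b c) (up' : cell2 D (id1 B b)) y x :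
  slide g y x ->
  cls (@rel _ _ _ _ A E) (ptri_comp (dn' o2 y) g (up' o2 dn) f up) =
  cls _ (ptri_comp dn' g (x o2 up' o2 dn) f up).
Proof.
rewrite /slide /ptri_comp; case ePhi: Phi => [P|P] e.
- rewrite e -(comp2_assoc _ up') op_mul -op_comp -comp2_assoc.
  by apply: Tri_slide; rewrite /slide ePhi.
- by rewrite e -(comp2_assoc _ up') ix_mul !comp2_assoc.
Qed.

Lemma Tri_comp_id_bot a b (A : cell1 B a a) (D E : cell1 B b b)
    (dn : cell2 (id1 B b) D) (f : Hom V a b) (up : cell2 A (id1 B a))
    (dn' : cell2 (id1 B b) E) (up' : cell2 D (id1 B b)) :
  cls (@rel _ _ _ _ A E) (ptri_comp dn' (idm V b) (up' o2 dn) f up) =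
  Tri (dn' o2 up' o2 dn) f up.
Proof.
rewrite /ptri_comp; case ePhi: Phi => [P|P].
- rewrite comp_idl -comp2_assoc; apply: eq_sym.
  by apply: Tri_slide; rewrite /slide ePhi.
- by rewrite ix_idm comp_idl comp2_assoc.
Qed.

Lemma pvcomp_step_top a a' b b' c c'
    (A : cell1 B a a') (D : cell1 B b b') (E : cell1 B c c')
    (x x' : presq A D) (y : presq D E) z z' :
  rel x x' -> pvcomp x y z -> pvcomp x' y z' -> cls (@rel _ _ _ _ _ _) z = cls _ z'.
Proof.
move=> h; move: y z z'; destruct h => w z z'; dependent destruction w => h1 h2.
- rewrite (pvcomp_fun h1 (pv_tg _ _ _ _)) (pvcomp_fun h2 (pv_tg _ _ _ _)).
  by rewrite comp2_assoc; apply: Tri_slide.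
- rewrite (pvcomp_fun h1 (pv_tt _ _ _ _ _ _)) (pvcomp_fun h2 (pv_tt _ _ _ _ _ _)).
  exact: Tri_comp_slide_top.
- rewrite (pvcomp_fun h1 (pv_tg _ _ _ _)) (pvcomp_fun h2 (pv_gg _ _)).
  by rewrite comp2_assoc; apply: Tri_id.
- rewrite (pvcomp_fun h1 (pv_tt _ _ _ _ _ _)) (pvcomp_fun h2 (pv_gt _ _ _ _)).
  exact: Tri_comp_id_top.
Qed.

Lemma pvcomp_step_bot a a' b b' c c'
    (A : cell1 B a a') (D : cell1 B b b') (E : cell1 B c c')
    (x : presq A D) (y y' : presq D E) z z' :
  rel y y' -> pvcomp x y z -> pvcomp x y' z' -> cls (@rel _ _ _ _ _ _) z = cls _ z'.
Proof.
move=> h; move: x z z'; destruct h => w z z'; dependent destruction w => h1 h2.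
- rewrite (pvcomp_fun h1 (pv_gt _ _ _ _)) (pvcomp_fun h2 (pv_gt _ _ _ _)).
  by rewrite -comp2_assoc; apply: Tri_slide.
- rewrite (pvcomp_fun h1 (pv_tt _ _ _ _ _ _)) (pvcomp_fun h2 (pv_tt _ _ _ _ _ _)).
  exact: Tri_comp_slide_bot.
- rewrite (pvcomp_fun h1 (pv_gt _ _ _ _)) (pvcomp_fun h2 (pv_gg _ _)).
  by rewrite -comp2_assoc; apply: Tri_id.
- rewrite (pvcomp_fun h1 (pv_tt _ _ _ _ _ _)) (pvcomp_fun h2 (pv_tg _ _ _ _)).
  exact: Tri_comp_id_bot.
Qed.

Lemma pvcomp_congr a a' b b' c c'
    (A : cell1 B a a') (D : cell1 B b b') (E : cell1 B c c')
    (x x' : presq A D) (y y' : presq D E) z z' :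
  clos_refl_sym_trans _ (@rel _ _ _ _ _ _) x x' ->
  clos_refl_sym_trans _ (@rel _ _ _ _ _ _) y y' ->
  pvcomp x y z -> pvcomp x' y' z' -> cls (@rel _ _ _ _ _ _) z = cls _ z'.
Proof.
move=> hx hy h h'; have [w hw] := pvcomp_ex x' y.
transitivity (cls (@rel _ _ _ _ _ _) w).
- elim: hx z w h hw {h' hy}.
  + by move=> {}x {}x' hx z w h hw; apply: pvcomp_step_top hx h hw.
  + by move=> {}x z w h hw; rewrite (pvcomp_fun h hw).
  + by move=> {}x {}x' _ IH z w h hw; rewrite (IH _ _ hw h).
  + move=> {}x {}x' x'' _ IH _ IH' z w h hw; have [v hv] := pvcomp_ex x' y.
    by rewrite (IH _ _ h hv) (IH' _ _ hv hw).
- elim: hy z' w h' hw {h hx}.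
  + by move=> {}y {}y' hy z' w h' hw; apply: pvcomp_step_bot hy hw h'.
  + by move=> {}y z' w h' hw; rewrite (pvcomp_fun h' hw).
  + by move=> {}y {}y' _ IH z' w h' hw; rewrite (IH _ _ hw h').
  + move=> {}y {}y' y'' _ IH _ IH' z' w h' hw; have [v hv] := pvcomp_ex x' y'.
    by rewrite (IH _ _ hv hw) (IH' _ _ h' hv).
Qed.

Lemma cvcomp_ex a a' b b' c c'
    (A : cell1 B a a') (D : cell1 B b b') (E : cell1 B c c')
    (q : csq D E) (p : csq A D) :
  exists r : csq A E, exists x y z,
    p = cls _ x /\ q = cls _ y /\ r = cls _ z /\ pvcomp x y z.
Proof.
have [x ->] := csq_case p; have [y ->] := csq_case q.
have [z h] := pvcomp_ex x y.
by exists (cls _ z); exists x; exists y; exists z.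
Qed.

Definition cvcomp a a' b b' c c'
    (A : cell1 B a a') (D : cell1 B b b') (E : cell1 B c c')
    (q : csq D E) (p : csq A D) : csq A E :=
  the (cvcomp_ex q p).

Lemma cvcomp_cls a a' b b' c c'
    (A : cell1 B a a') (D : cell1 B b b') (E : cell1 B c c')
    (x : presq A D) (y : presq D E) z :
  pvcomp x y z -> cvcomp (cls _ y) (cls _ x) = cls _ z.
Proof.
rewrite /cvcomp => h.
have [x' [y' [z' [ex [ey [-> h']]]]]] := theP (cvcomp_ex (cls _ y) (cls _ x)).
apply: pvcomp_congr h' h; apply: rst_sym; exact: cls_inj.
Qed.

Lemma cvcomp_gg a a' (A D E : cell1 B a a') (t : cell2 D E) (s : cell2 A D) :
  cvcomp (Glob t) (Glob s) = Glob (t o2 s).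
Proof. by apply: cvcomp_cls; constructor. Qed.

Lemma cvcomp_tg a b (A A' : cell1 B a a) (D : cell1 B b b) (s : cell2 A A')
    (dn : cell2 (id1 B b) D) (f : Hom V a b) (up : cell2 A' (id1 B a)) :
  cvcomp (Tri dn f up) (Glob s) = Tri dn f (up o2 s).
Proof. by apply: cvcomp_cls; constructor. Qed.

Lemma cvcomp_gt a b (A : cell1 B a a) (D D' : cell1 B b b) (t : cell2 D D')
    (dn : cell2 (id1 B b) D) (f : Hom V a b) (up : cell2 A (id1 B a)) :
  cvcomp (Glob t) (Tri dn f up) = Tri (t o2 dn) f up.
Proof. by apply: cvcomp_cls; constructor. Qed.

Lemma cvcomp_tt a b c (A : cell1 B a a) (D : cell1 B b b) (E : cell1 B c c)
    (dn : cell2 (id1 B b) D) (f : Hom V a b) (up : cell2 A (id1 B a))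
    (dn' : cell2 (id1 B c) E) (g : Hom V b c) (up' : cell2 D (id1 B b)) :
  cvcomp (Tri dn' g up') (Tri dn f up) =
  cls _ (ptri_comp dn' g (up' o2 dn) f up).
Proof. by apply: cvcomp_cls; constructor. Qed.

(** [phcomp] extended to pairs of a 2-cell and a triple on an identity. *)
Inductive phcomp' : forall a a' a'' b b' b''
    (A : cell1 B a a') (A' : cell1 B a' a'') (D : cell1 B b b') (D' : cell1 B b' b''),
    presq A D -> presq A' D' -> presq (A *1 A') (D *1 D') -> Prop :=
| ph'_gg a a' a'' (A D : cell1 B a a') (A' D' : cell1 B a' a'')
    (s : cell2 A D) (t : cell2 A' D') :
    phcomp' (pglob s) (pglob t) (pglob (s *2 t))
| ph'_gt a a' (A D : cell1 B a a') (A' D' : cell1 B a' a') (s : cell2 A D)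
    (dn : cell2 (id1 B a') D') (up : cell2 A' (id1 B a')) :
    phcomp' (pglob s) (ptri dn (idm V a') up) (pglob (s *2 (dn o2 up)))
| ph'_tg a a' (A D : cell1 B a a) (A' D' : cell1 B a a') (t : cell2 A' D')
    (dn : cell2 (id1 B a) D) (up : cell2 A (id1 B a)) :
    phcomp' (ptri dn (idm V a) up) (pglob t) (pglob ((dn o2 up) *2 t))
| ph'_tt a b (A A' : cell1 B a a) (D D' : cell1 B b b) (f : Hom V a b)
    (dn : cell2 (id1 B b) D) (up : cell2 A (id1 B a))
    (dn' : cell2 (id1 B b) D') (up' : cell2 A' (id1 B a)) :
    phcomp' (ptri dn f up) (ptri dn' f up')
      (ptri ((dn *2 dn') o2 lunit2_inv (id1 B b)) f
            (lunit2 (id1 B a) o2 (up *2 up'))).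

Lemma phcomp'_fun a a' a'' b b' b''
    (A : cell1 B a a') (A' : cell1 B a' a'') (D : cell1 B b b') (D' : cell1 B b' b'')
    (x : presq A D) (y : presq A' D') z z' :
  phcomp' x y z -> phcomp' x y z' -> z = z'.
Proof.
by move=> h; move: z'; destruct h => z' h'; dependent destruction h'.
Qed.

Lemma phcomp'_ex a a' a'' b b' b''
    (A : cell1 B a a') (A' : cell1 B a' a'') (D : cell1 B b b') (D' : cell1 B b' b'')
    (x : presq A D) (y : presq A' D') :
  prfr x = plfr y -> exists z, phcomp' x y z.
Proof.
dependent destruction x; dependent destruction y => /= e; subst;
  eexists; by constructor.
Qed.

Lemma phcomp_phcomp' a a' a'' b b' b''
    (A : cell1 B a a') (A' : cell1 B a' a'') (D : cell1 B b b') (D' : cell1 B b' b'')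
    (x : presq A D) (y : presq A' D') z :
  phcomp x y z -> phcomp' x y z.
Proof. by case; constructor. Qed.

Lemma hcomp2_slide_dnl b (D D' : cell1 B b b)
    (dn : cell2 (id1 B b) D) (dn' : cell2 (id1 B b) D') (y : pi2 X b) :
  ((dn o2 y) *2 dn') o2 lunit2_inv (id1 B b)
  = ((dn *2 dn') o2 lunit2_inv (id1 B b)) o2 y.
Proof.
rewrite -{1}(comp2_idr dn') hcomp2_comp -!comp2_assoc; congr (_ o2 _).
by rewrite hcomp2_lunit_inv comp2_idr.
Qed.

Lemma hcomp2_slide_dnr b (D D' : cell1 B b b)
    (dn : cell2 (id1 B b) D) (dn' : cell2 (id1 B b) D') (y : pi2 X b) :
  (dn *2 (dn' o2 y)) o2 lunit2_inv (id1 B b)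
  = ((dn *2 dn') o2 lunit2_inv (id1 B b)) o2 y.
Proof.
rewrite -{1}(comp2_idr dn) hcomp2_comp -!comp2_assoc; congr (_ o2 _).
by rewrite hcomp2_lunit_inv comp2_idl.
Qed.

Lemma hcomp2_slide_upl a (A A' : cell1 B a a)
    (up : cell2 A (id1 B a)) (up' : cell2 A' (id1 B a)) (x : pi2 X a) :
  lunit2 (id1 B a) o2 ((x o2 up) *2 up') = x o2 (lunit2 (id1 B a) o2 (up *2 up')).
Proof.
rewrite -{1}(comp2_idl up') hcomp2_comp !comp2_assoc; congr (_ o2 _).
by rewrite lunit_hcomp2 comp2_idr.
Qed.

Lemma hcomp2_slide_upr a (A A' : cell1 B a a)
    (up : cell2 A (id1 B a)) (up' : cell2 A' (id1 B a)) (x : pi2 X a) :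
  lunit2 (id1 B a) o2 (up *2 (x o2 up')) = x o2 (lunit2 (id1 B a) o2 (up *2 up')).
Proof.
rewrite -{1}(comp2_idl up) hcomp2_comp !comp2_assoc; congr (_ o2 _).
by rewrite lunit_hcomp2 comp2_idl.
Qed.

Lemma hcomp2_unit_mid a (A A' D D' : cell1 B a a)
    (dn : cell2 (id1 B a) D) (up : cell2 A (id1 B a))
    (dn' : cell2 (id1 B a) D') (up' : cell2 A' (id1 B a)) :
  (dn *2 dn') o2 lunit2_inv (id1 B a) o2 (lunit2 (id1 B a) o2 (up *2 up'))
  = (dn o2 up) *2 (dn' o2 up').
Proof.
rewrite comp2_assoc -(comp2_assoc (_ *2 _)) lunit2K comp2_idr.
by rewrite hcomp2_comp.
Qed.

Lemma phcomp'_frames a a' a'' b b' b''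
    (A : cell1 B a a') (A' : cell1 B a' a'') (D : cell1 B b b') (D' : cell1 B b' b'')
    (x : presq A D) (y : presq A' D') z :
  phcomp' x y z -> prfr x = plfr y.
Proof. by case. Qed.

Lemma slide_idm a (y x : pi2 X a) : slide (idm V a) y x -> y = x.
Proof. by rewrite /slide; case: Phi => P ->; rewrite ?op_idm ?ix_idm. Qed.

Lemma phcomp'_step_l a a' a'' b b' b''
    (A : cell1 B a a') (A' : cell1 B a' a'') (D : cell1 B b b') (D' : cell1 B b' b'')
    (x x' : presq A D) (y : presq A' D') z z' :
  rel x x' -> phcomp' x y z -> phcomp' x' y z' ->
  cls (@rel _ _ _ _ _ _) z = cls _ z'.
Proof.
move=> h; move: a'' b'' A' D' y z z'; destruct h => a'' b'' A' D' w z z'.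
- dependent destruction w => h1 h2; have /= e := phcomp'_frames h1; subst f.
  + rewrite (phcomp'_fun h1 (ph'_tg _ _ _)) (phcomp'_fun h2 (ph'_tg _ _ _)).
    by rewrite -(slide_idm H) comp2_assoc.
  + rewrite (phcomp'_fun h1 (ph'_tt _ _ _ _ _)) (phcomp'_fun h2 (ph'_tt _ _ _ _ _)).
    rewrite hcomp2_slide_dnl hcomp2_slide_upl; exact: Tri_slide.
- dependent destruction w => h1 h2; have /= e := phcomp'_frames h1; subst.
  + rewrite (phcomp'_fun h1 (ph'_tg _ _ _)) (phcomp'_fun h2 (ph'_gg _ _)) //.
  + rewrite (phcomp'_fun h1 (ph'_tt _ _ _ _ _)) (phcomp'_fun h2 (ph'_gt _ _ _)).
    rewrite -hcomp2_unit_mid; exact: Tri_id.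
Qed.

Lemma phcomp'_step_r a a' a'' b b' b''
    (A : cell1 B a a') (A' : cell1 B a' a'') (D : cell1 B b b') (D' : cell1 B b' b'')
    (x : presq A D) (y y' : presq A' D') z z' :
  rel y y' -> phcomp' x y z -> phcomp' x y' z' ->
  cls (@rel _ _ _ _ _ _) z = cls _ z'.
Proof.
move=> h; move: a b A D x z z'; destruct h => a'' b'' A' D' w z z'.
- dependent destruction w => h1 h2; have /= e := phcomp'_frames h1; subst f.
  + rewrite (phcomp'_fun h1 (ph'_gt _ _ _)) (phcomp'_fun h2 (ph'_gt _ _ _)).
    by rewrite -(slide_idm H) comp2_assoc.
  + rewrite (phcomp'_fun h1 (ph'_tt _ _ _ _ _)) (phcomp'_fun h2 (ph'_tt _ _ _ _ _)).
    rewrite hcomp2_slide_dnr hcomp2_slide_upr; exact: Tri_slide.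
- dependent destruction w => h1 h2; have /= e := phcomp'_frames h1; subst.
  + rewrite (phcomp'_fun h1 (ph'_gt _ _ _)) (phcomp'_fun h2 (ph'_gg _ _)) //.
  + rewrite (phcomp'_fun h1 (ph'_tt _ _ _ _ _)) (phcomp'_fun h2 (ph'_tg _ _ _)).
    rewrite -hcomp2_unit_mid; exact: Tri_id.
Qed.

Lemma phcomp'_congr a a' a'' b b' b''
    (A : cell1 B a a') (A' : cell1 B a' a'') (D : cell1 B b b') (D' : cell1 B b' b'')
    (x x' : presq A D) (y y' : presq A' D') z z' :
  clos_refl_sym_trans _ (@rel _ _ _ _ _ _) x x' ->
  clos_refl_sym_trans _ (@rel _ _ _ _ _ _) y y' ->
  phcomp' x y z -> phcomp' x' y' z' -> cls (@rel _ _ _ _ _ _) z = cls _ z'.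
Proof.
move=> hx hy h h'.
have [w hw] : exists w, phcomp' x' y w.
  apply: phcomp'_ex.
  by rewrite (phcomp'_frames h') (proj1 (frames_inv hy)).
transitivity (cls (@rel _ _ _ _ _ _) w).
- elim: hx z w h hw {h' hy}.
  + by move=> {}x {}x' hx z w h hw; apply: phcomp'_step_l hx h hw.
  + by move=> {}x z w h hw; rewrite (phcomp'_fun h hw).
  + by move=> {}x {}x' _ IH z w h hw; rewrite (IH _ _ hw h).
  + move=> {}x {}x' x'' _ IH hx' IH' z w h hw.
    have [v hv] : exists v, phcomp' x' y v.
      apply: phcomp'_ex.
      by rewrite (proj2 (frames_inv hx')) (phcomp'_frames hw).
    by rewrite (IH _ _ h hv) (IH' _ _ hv hw).
- elim: hy z' w h' hw {h hx}.
  + by move=> {}y {}y' hy z' w h' hw; apply: phcomp'_step_r hy hw h'.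
  + by move=> {}y z' w h' hw; rewrite (phcomp'_fun h' hw).
  + by move=> {}y {}y' _ IH z' w h' hw; rewrite (IH _ _ hw h').
  + move=> {}y {}y' y'' hy IH _ IH' z' w h' hw.
    have [v hv] : exists v, phcomp' x' y' v.
      apply: phcomp'_ex.
      by rewrite (phcomp'_frames hw) (proj1 (frames_inv hy)).
    by rewrite (IH _ _ hv hw) (IH' _ _ h' hv).
Qed.

Lemma phcomp_ex a a' a'' b b' b''
    (A : cell1 B a a') (A' : cell1 B a' a'') (D : cell1 B b b') (D' : cell1 B b' b'')
    (p : csq A D) (q : csq A' D') :
  crfr p = clfr q ->
  exists r : csq (A *1 A') (D *1 D'), exists x y z,
    p = cls _ x /\ q = cls _ y /\ r = cls _ z /\ phcomp x y z.
Proof.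
have [x ->] := csq_case p; have [y ->] := csq_case q.
rewrite crfr_cls clfr_cls.
dependent destruction x; dependent destruction y => /= e; subst.
- do 4 eexists; do 3 (split; first by []); constructor.
- rewrite -[cls _ (ptri _ _ _)]/(Tri _ _ _) Tri_id.
  do 4 eexists; do 3 (split; first by []); constructor.
- rewrite -[cls _ (ptri _ _ _)]/(Tri _ _ _) Tri_id.
  do 4 eexists; do 3 (split; first by []); constructor.
- do 4 eexists; do 3 (split; first by []); constructor.
Qed.

Definition chcomps a a' a'' b b' b''
    (A : cell1 B a a') (A' : cell1 B a' a'') (D : cell1 B b b') (D' : cell1 B b' b'')
    (p : csq A D) (q : csq A' D') (e : crfr p = clfr q) : csq (A *1 A') (D *1 D') :=
  the (phcomp_ex e).

Arguments chcomps {a a' a'' b b' b'' A A' D D'} p q e.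

Lemma chcomps_cls a a' a'' b b' b''
    (A : cell1 B a a') (A' : cell1 B a' a'') (D : cell1 B b b') (D' : cell1 B b' b'')
    (x : presq A D) (y : presq A' D') z e :
  phcomp x y z -> chcomps (cls _ x) (cls _ y) e = cls _ z.
Proof.
rewrite /chcomps => h.
have [x' [y' [z' [ex [ey [-> h']]]]]] := theP (phcomp_ex e).
apply: phcomp'_congr (phcomp_phcomp' h') (phcomp_phcomp' h);
  apply: rst_sym; exact: cls_inj.
Qed.

Lemma chcomps_gg a a' a'' (A D : cell1 B a a') (A' D' : cell1 B a' a'')
    (s : cell2 A D) (t : cell2 A' D') e :
  chcomps (Glob s) (Glob t) e = Glob (s *2 t).
Proof. by apply: chcomps_cls; constructor. Qed.

Lemma chcomps_tt a b (A A' : cell1 B a a) (D D' : cell1 B b b) (f : Hom V a b)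
    (dn : cell2 (id1 B b) D) (up : cell2 A (id1 B a))
    (dn' : cell2 (id1 B b) D') (up' : cell2 A' (id1 B a)) e :
  chcomps (Tri dn f up) (Tri dn' f up') e =
  Tri ((dn *2 dn') o2 lunit2_inv (id1 B b)) f (lunit2 (id1 B a) o2 (up *2 up')).
Proof. by apply: chcomps_cls; constructor. Qed.

Lemma cvcomp_tt_op P : Phi = OpInd P ->
  forall a b c (A : cell1 B a a) (D : cell1 B b b) (E : cell1 B c c)
    (dn : cell2 (id1 B b) D) (f : Hom V a b) (up : cell2 A (id1 B a))
    (dn' : cell2 (id1 B c) E) (g : Hom V b c) (up' : cell2 D (id1 B b)),
  cvcomp (Tri dn' g up') (Tri dn f up) =
  Tri dn' (g oV f) (op_map P f (up' o2 dn) o2 up).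
Proof. by move=> e *; rewrite cvcomp_tt /ptri_comp e. Qed.

Lemma cvcomp_tt_ix P : Phi = Ind P ->
  forall a b c (A : cell1 B a a) (D : cell1 B b b) (E : cell1 B c c)
    (dn : cell2 (id1 B b) D) (f : Hom V a b) (up : cell2 A (id1 B a))
    (dn' : cell2 (id1 B c) E) (g : Hom V b c) (up' : cell2 D (id1 B b)),
  cvcomp (Tri dn' g up') (Tri dn f up) =
  Tri (dn' o2 ix_map P g (up' o2 dn)) (g oV f) up.
Proof. by move=> e *; rewrite cvcomp_tt /ptri_comp e. Qed.

Lemma clfr_Glob a a' (A D : cell1 B a a') (s : cell2 A D) : clfr (Glob s) = idm V a.
Proof. exact: clfr_cls. Qed.

Lemma crfr_Glob a a' (A D : cell1 B a a') (s : cell2 A D) : crfr (Glob s) = idm V a'.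
Proof. exact: crfr_cls. Qed.

Lemma clfr_Tri a b (A : cell1 B a a) (D : cell1 B b b)
    (dn : cell2 (id1 B b) D) (f : Hom V a b) (up : cell2 A (id1 B a)) :
  clfr (Tri dn f up) = f.
Proof. exact: clfr_cls. Qed.

Lemma crfr_Tri a b (A : cell1 B a a) (D : cell1 B b b)
    (dn : cell2 (id1 B b) D) (f : Hom V a b) (up : cell2 A (id1 B a)) :
  crfr (Tri dn f up) = f.
Proof. exact: crfr_cls. Qed.

Definition frE := (clfr_Glob, crfr_Glob, clfr_Tri, crfr_Tri).

Lemma csq_elim (P : forall a a' b b' (A : cell1 B a a') (D : cell1 B b b'), csq A D -> Prop) :
  (forall a a' (A D : cell1 B a a') (s : cell2 A D), P _ _ _ _ _ _ (Glob s)) ->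
  (forall a b (A : cell1 B a a) (D : cell1 B b b)
    (dn : cell2 (id1 B b) D) (f : Hom V a b) (up : cell2 A (id1 B a)),
    P _ _ _ _ _ _ (Tri dn f up)) ->
  forall a a' b b' (A : cell1 B a a') (D : cell1 B b b') (p : csq A D), P _ _ _ _ _ _ p.
Proof.
move=> hG hT a a' b b' A D p; have [x ->] := csq_case p.
by destruct x; [apply: hG|apply: hT].
Qed.

Ltac csq_dest p :=
  let x := fresh "x" in let e := fresh "e" in
  destruct (csq_case p) as [x e]; subst p; dependent destruction x;
  repeat match goal with
  | |- context [cls (@rel _ _ _ _ ?A ?D) (pglob ?t)] =>
      change (cls (@rel _ _ _ _ A D) (pglob t)) with (Glob t)
  | |- context [cls (@rel _ _ _ _ ?A ?D) (ptri ?d ?f ?u)] =>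
      change (cls (@rel _ _ _ _ A D) (ptri d f u)) with (Tri d f u)
  end.

Definition cvE := (cvcomp_gg, cvcomp_gt, cvcomp_tg).

Lemma cvcomp_assoc a a' b b' c c' d d' (A : cell1 B a a') (D : cell1 B b b')
   (E : cell1 B c c') (F : cell1 B d d') (r : csq E F) (q : csq D E) (p : csq A D) :
  cvcomp r (cvcomp q p) = cvcomp (cvcomp r q) p.
Proof.
csq_dest p; csq_dest q; csq_dest r; rewrite ?cvE ?comp2_assoc //;
  case ePhi: Phi => [P|P];
  rewrite ?(cvcomp_tt_op ePhi) ?(cvcomp_tt_ix ePhi) ?cvE
          ?(cvcomp_tt_op ePhi) ?(cvcomp_tt_ix ePhi) ?comp_assoc ?comp2_assoc //.
- by rewrite -(comp2_assoc _ up0 dn) op_mul op_comp.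
- by rewrite ix_mul ix_comp comp2_assoc.
Qed.

Lemma cvcomp_idl a a' b b' (A : cell1 B a a') (D : cell1 B b b') (p : csq A D) :
  cvcomp (Glob (id2 D)) p = p.
Proof. by csq_dest p; rewrite ?cvE comp2_idl. Qed.

Lemma cvcomp_idr a a' b b' (A : cell1 B a a') (D : cell1 B b b') (p : csq A D) :
  cvcomp p (Glob (id2 A)) = p.
Proof. by csq_dest p; rewrite ?cvE comp2_idr. Qed.

Lemma clfr_comp a a' b b' c c' (A : cell1 B a a') (D : cell1 B b b') (E : cell1 B c c')
  (q : csq D E) (p : csq A D) : clfr (cvcomp q p) = clfr q oV clfr p.
Proof.
csq_dest p; csq_dest q; rewrite ?cvE ?frE ?comp_idl ?comp_idr //.
by case ePhi: Phi => [P|P]; rewrite ?(cvcomp_tt_op ePhi) ?(cvcomp_tt_ix ePhi) frE.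
Qed.

Lemma crfr_comp a a' b b' c c' (A : cell1 B a a') (D : cell1 B b b') (E : cell1 B c c')
  (q : csq D E) (p : csq A D) : crfr (cvcomp q p) = crfr q oV crfr p.
Proof.
csq_dest p; csq_dest q; rewrite ?cvE ?frE ?comp_idl ?comp_idr //.
by case ePhi: Phi => [P|P]; rewrite ?(cvcomp_tt_op ePhi) ?(cvcomp_tt_ix ePhi) frE.
Qed.

Definition cusq a b (f : Hom V a b) : csq (id1 B a) (id1 B b) :=
  Tri (id2 (id1 B b)) f (id2 (id1 B a)).

Lemma cusq_id a : cusq (idm V a) = Glob (id2 (id1 B a)).
Proof. by rewrite /cusq Tri_id comp2_idl. Qed.

Lemma cusq_comp a b c (g : Hom V b c) (f : Hom V a b) :
  cusq (g oV f) = cvcomp (cusq g) (cusq f).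
Proof.
rewrite /cusq; case ePhi: Phi => [P|P];
  rewrite ?(cvcomp_tt_op ePhi) ?(cvcomp_tt_ix ePhi).
- by rewrite comp2_idl op_one comp2_idl.
- by rewrite !comp2_idl ix_one.
Qed.

Lemma chcomps_irr (a a' a'' b b' b'' : O)
    (A : cell1 B a a') (A' : cell1 B a' a'') (D : cell1 B b b') (D' : cell1 B b' b'')
    (p p' : csq A D) (q q' : csq A' D') e e' :
  p = p' -> q = q' -> chcomps p q e = chcomps p' q' e'.
Proof.
move=> ep eq; subst p' q'; congr (chcomps p q _); exact: proof_irrelevance.
Qed.

Inductive chpair : forall a a' a'' b b' b''
    (A : cell1 B a a') (A' : cell1 B a' a'') (D : cell1 B b b') (D' : cell1 B b' b''),
    csq A D -> csq A' D' -> Prop :=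
| chpair_gg a a' a'' (A D : cell1 B a a') (A' D' : cell1 B a' a'')
    (s : cell2 A D) (t : cell2 A' D') : chpair (Glob s) (Glob t)
| chpair_tt a b (A A' : cell1 B a a) (D D' : cell1 B b b) (f : Hom V a b)
    (dn : cell2 (id1 B b) D) (up : cell2 A (id1 B a))
    (dn' : cell2 (id1 B b) D') (up' : cell2 A' (id1 B a)) :
    chpair (Tri dn f up) (Tri dn' f up').

Lemma chpairP a a' a'' b b' b''
    (A : cell1 B a a') (A' : cell1 B a' a'') (D : cell1 B b b') (D' : cell1 B b' b'')
    (p : csq A D) (q : csq A' D') : crfr p = clfr q -> chpair p q.
Proof.
csq_dest p; csq_dest q; rewrite ?frE => e; subst; rewrite ?Tri_id; constructor.
Qed.

Lemma clfr_chcomps a a' a'' b b' b''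
    (A : cell1 B a a') (A' : cell1 B a' a'') (D : cell1 B b b') (D' : cell1 B b' b'')
    (p : csq A D) (q : csq A' D') (e : crfr p = clfr q) :
  clfr (chcomps p q e) = clfr p.
Proof.
move: (e); case: (chpairP e) => *; by rewrite ?chcomps_gg ?chcomps_tt ?frE.
Qed.

Lemma crfr_chcomps a a' a'' b b' b''
    (A : cell1 B a a') (A' : cell1 B a' a'') (D : cell1 B b b') (D' : cell1 B b' b'')
    (p : csq A D) (q : csq A' D') (e : crfr p = clfr q) :
  crfr (chcomps p q e) = crfr q.
Proof.
move: (e); case: (chpairP e) => *; by rewrite ?chcomps_gg ?chcomps_tt ?frE.
Qed.

Lemma chcompsG a a' a'' (A D : cell1 B a a') (A' D' : cell1 B a' a'')
    (s : cell2 A D) (t : cell2 A' D') p q (e : crfr p = clfr q) :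
  p = Glob s -> q = Glob t -> chcomps p q e = Glob (s *2 t).
Proof. move=> ep eq; subst p q; exact: chcomps_gg. Qed.

Lemma chcompsT a b (A A' : cell1 B a a) (D D' : cell1 B b b) (f : Hom V a b)
    (dn : cell2 (id1 B b) D) (up : cell2 A (id1 B a))
    (dn' : cell2 (id1 B b) D') (up' : cell2 A' (id1 B a)) p q (e : crfr p = clfr q) :
  p = Tri dn f up -> q = Tri dn' f up' ->
  chcomps p q e =
  Tri ((dn *2 dn') o2 lunit2_inv (id1 B b)) f (lunit2 (id1 B a) o2 (up *2 up')).
Proof. move=> ep eq; subst p q; exact: chcomps_tt. Qed.

Lemma lunit_hcomp2_mid a (A A' : cell1 B a a)
    (up : cell2 A (id1 B a)) (up' : cell2 A' (id1 B a)) (y x : pi2 X a) :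
  lunit2 (id1 B a) o2 ((y o2 up) *2 (x o2 up')) =
  y o2 x o2 (lunit2 (id1 B a) o2 (up *2 up')).
Proof. by rewrite hcomp2_slide_upl hcomp2_slide_upr comp2_assoc. Qed.

Lemma lunit_conj a (D D' : cell1 B a a)
    (dn : cell2 (id1 B a) D) (up : cell2 D (id1 B a))
    (dn' : cell2 (id1 B a) D') (up' : cell2 D' (id1 B a)) :
  lunit2 (id1 B a) o2 (up *2 up') o2 ((dn *2 dn') o2 lunit2_inv (id1 B a))
  = (up o2 dn) o2 (up' o2 dn').
Proof.
rewrite comp2_assoc -(comp2_assoc (lunit2 _)) -hcomp2_comp lunit_hcomp2.
by rewrite -comp2_assoc lunit2VK comp2_idr.
Qed.

Lemma chcomps_interchange a a' a'' b b' b'' c c' c''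
    (A : cell1 B a a') (A' : cell1 B a' a'') (D : cell1 B b b') (D' : cell1 B b' b'')
    (E : cell1 B c c') (E' : cell1 B c' c'')
    (p : csq A D) (q : csq D E) (p' : csq A' D') (q' : csq D' E')
    (e : crfr (cvcomp q p) = clfr (cvcomp q' p')) ep eq :
  chcomps (cvcomp q p) (cvcomp q' p') e = cvcomp (chcomps q q' eq) (chcomps p p' ep).
Proof.
move: q q' e (ep) eq; case: (chpairP ep) => {ep a a' a'' b b' b'' A A' D D' p p'}.
- move=> a a' a'' A D A' D' s t q q' e ep eq; move: e (eq) => e' eq'; move: eq eq' e'.
  csq_dest q; csq_dest q' => eq0; have h := eq0; rewrite ?frE in h; subst;
    clear eq0; rewrite ?Tri_id => eq e.
  1-3: by rewrite (chcompsG e (cvcomp_gg _ _) (cvcomp_gg _ _)) !chcomps_gg cvE hcomp2_comp.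
  rewrite (chcompsT e (cvcomp_tg _ _ _ _) (cvcomp_tg _ _ _ _)) chcomps_gg chcomps_tt cvE.
  by rewrite hcomp2_comp comp2_assoc.
- move=> a b A A' D D' f dn up dn' up' q q' e ep eq; move: e (eq) => e' eq'; move: eq eq' e'.
  csq_dest q; csq_dest q' => eq0; have h := eq0; rewrite ?frE in h; subst;
    clear eq0; rewrite ?Tri_id => eq e.
  1-3: rewrite (chcompsT e (cvcomp_gt _ _ _ _) (cvcomp_gt _ _ _ _)) chcomps_gg chcomps_tt cvE.
  1-3: by rewrite hcomp2_comp comp2_assoc.
  case ePhi: Phi => [P|P].
  + rewrite (chcompsT e (cvcomp_tt_op ePhi _ _ _ _ _ _) (cvcomp_tt_op ePhi _ _ _ _ _ _)).
    rewrite !chcomps_tt (cvcomp_tt_op ePhi) lunit_hcomp2_mid -op_mul.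
    by rewrite lunit_conj.
  + rewrite (chcompsT e (cvcomp_tt_ix ePhi _ _ _ _ _ _) (cvcomp_tt_ix ePhi _ _ _ _ _ _)).
    rewrite !chcomps_tt (cvcomp_tt_ix ePhi) hcomp2_slide_dnl hcomp2_slide_dnr -comp2_assoc -ix_mul.
    by rewrite lunit_conj pi2_comm.
Qed.

Lemma assoc_lunit_inv a :
  assoc2 (id1 B a) (id1 B a) (id1 B a) o2 (lunit2_inv (id1 B a) *2 id2 (id1 B a))
  = id2 (id1 B a) *2 lunit2_inv (id1 B a).
Proof.
have e : (id2 (id1 B a) *2 lunit2_inv (id1 B a)) o2 (id2 (id1 B a) *2 lunit2 (id1 B a)) = id2 _.
  by rewrite -hcomp2_comp lunit2K comp2_idl hcomp2_id.
apply: (comp2_cancel_mono e).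
rewrite comp2_assoc triangle2 -lunit2_id1 -!hcomp2_comp lunit2VK comp2_idl.
by [].
Qed.

Lemma hcomp2_assoc_dn b (D D' D'' : cell1 B b b) (dn : cell2 (id1 B b) D)
    (dn' : cell2 (id1 B b) D') (dn'' : cell2 (id1 B b) D'') :
  assoc2 D D' D'' o2 ((((dn *2 dn') o2 lunit2_inv (id1 B b)) *2 dn'')
                      o2 lunit2_inv (id1 B b))
  = (dn *2 ((dn' *2 dn'') o2 lunit2_inv (id1 B b))) o2 lunit2_inv (id1 B b).
Proof.
rewrite -{1}(comp2_idr dn'') hcomp2_comp !comp2_assoc assoc2_nat; congr (_ o2 _).
by rewrite -comp2_assoc assoc_lunit_inv -hcomp2_comp comp2_idr.
Qed.

Lemma hcomp2_assoc_up a (A A' A'' : cell1 B a a) (up : cell2 A (id1 B a))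
    (up' : cell2 A' (id1 B a)) (up'' : cell2 A'' (id1 B a)) :
  lunit2 (id1 B a) o2 ((lunit2 (id1 B a) o2 (up *2 up')) *2 up'')
  = lunit2 (id1 B a) o2 (up *2 (lunit2 (id1 B a) o2 (up' *2 up''))) o2 assoc2 A A' A''.
Proof.
rewrite -{1}(comp2_idl up'') hcomp2_comp -!comp2_assoc; congr (_ o2 _).
rewrite {1}lunit2_id1 -triangle2 -comp2_assoc assoc2_nat comp2_assoc -hcomp2_comp.
by rewrite comp2_idl.
Qed.

Lemma chcomps_assoc_nat a b c d a' b' c' d'
    (A : cell1 B a b) (D : cell1 B b c) (E : cell1 B c d)
    (A' : cell1 B a' b') (D' : cell1 B b' c') (E' : cell1 B c' d')
    (p : csq A A') (q : csq D D') (r : csq E E')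
    (epq : crfr p = clfr q) (eqr : crfr q = clfr r)
    (epqr : crfr (chcomps p q epq) = clfr r) (epqr' : crfr p = clfr (chcomps q r eqr)) :
  cvcomp (Glob (assoc2 A' D' E')) (chcomps (chcomps p q epq) r epqr)
  = cvcomp (chcomps p (chcomps q r eqr) epqr') (Glob (assoc2 A D E)).
Proof.
move: epq eqr epqr epqr'.
csq_dest p; csq_dest q; csq_dest r => epq eqr;
  have h := epq; rewrite ?frE in h; subst;
  have h' := eqr; rewrite ?frE in h'; subst;
  revert epq eqr; rewrite ?Tri_id => epq eqr e1 e2.
all: try (by rewrite (chcompsG e1 (chcomps_gg _) eq_refl)
     (chcompsG e2 eq_refl (chcomps_gg _)) !cvE assoc2_nat).
rewrite (chcompsT e1 (chcomps_tt _) eq_refl).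
rewrite (chcompsT e2 eq_refl (chcomps_tt _)) !cvE.
by rewrite hcomp2_assoc_dn hcomp2_assoc_up.
Qed.

Lemma chcomps_lunit_nat a a' b b' (A : cell1 B a a') (D : cell1 B b b') (p : csq A D)
    (e : crfr (cusq (clfr p)) = clfr p) :
  cvcomp (Glob (lunit2 D)) (chcomps (cusq (clfr p)) p e) = cvcomp p (Glob (lunit2 A)).
Proof.
move: e; csq_dest p => e.
- rewrite (@chcompsG _ _ _ _ _ _ _ (id2 _) _ _ _ e _ eq_refl) ?cvE ?lunit2_nat //.
  by rewrite frE cusq_id.
- rewrite (@chcompsT _ _ _ _ _ _ _ (id2 _) (id2 _) _ _ _ _ e _ eq_refl) ?cvE.
  + by rewrite frE.
  + rewrite comp2_assoc lunit2_nat -comp2_assoc lunit2VK comp2_idr.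
    by rewrite lunit2_nat.
Qed.

Lemma chcomps_runit_nat a a' b b' (A : cell1 B a a') (D : cell1 B b b') (p : csq A D)
    (e : crfr p = clfr (cusq (crfr p))) :
  cvcomp (Glob (runit2 D)) (chcomps p (cusq (crfr p)) e) = cvcomp p (Glob (runit2 A)).
Proof.
move: e; csq_dest p => e.
- rewrite (@chcompsG _ _ _ _ _ _ _ _ (id2 _) _ _ e eq_refl) ?cvE ?runit2_nat //.
  by rewrite frE cusq_id.
- rewrite (@chcompsT _ _ _ _ _ _ _ _ _ (id2 _) (id2 _) _ _ e eq_refl) ?cvE.
  + by rewrite frE.
  + rewrite comp2_assoc runit2_nat lunit2_id1 runit2_nat -comp2_assoc.
    by rewrite -{1}lunit2_id1 lunit2VK comp2_idr.
Qed.

(** The double category [B x|_Phi B^*] of the decorated bicategory [X = (B^*, B)]. *)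
Definition crossed : DoubleCategory.
Proof.
unshelve refine {|
  ob := O;
  vcat := V;
  hor := cell1 B;
  sq := csq;
  sqid := fun a a' A => Glob (id2 A);
  vcomp := cvcomp;
  lfr := clfr;
  rfr := crfr;
  hid := id1 B;
  usq := cusq;
  hcomp := @hcomp1 _ B;
  hcomps := @chcomps;
  assoc := fun a b c d A D E => Glob (assoc2 A D E);
  assoc_inv := fun a b c d A D E => Glob (assoc2_inv A D E);
  lunit := fun a b A => Glob (lunit2 A);
  lunit_inv := fun a b A => Glob (lunit2_inv A);
  runit := fun a b A => Glob (runit2 A);
  runit_inv := fun a b A => Glob (runit2_inv A)
|}.
- exact: cvcomp_assoc.
- exact: cvcomp_idl.
- exact: cvcomp_idr.
- abstract (by move=> *; rewrite frE).
- abstract (by move=> *; rewrite frE).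
- exact: clfr_comp.
- exact: crfr_comp.
- exact: cusq_id.
- exact: cusq_comp.
- abstract (by move=> *; rewrite frE).
- abstract (by move=> *; rewrite frE).
- exact: clfr_chcomps.
- exact: crfr_chcomps.
- abstract (by move=> *; rewrite chcomps_gg hcomp2_id).
- exact: chcomps_interchange.
- abstract (by move=> *; rewrite frE).
- abstract (by move=> *; rewrite frE).
- abstract (by move=> *; rewrite cvE assoc2K).
- abstract (by move=> *; rewrite cvE assoc2VK).
- exact: chcomps_assoc_nat.
- abstract (by move=> *; rewrite frE).
- abstract (by move=> *; rewrite frE).
- abstract (by move=> *; rewrite cvE lunit2K).
- abstract (by move=> *; rewrite cvE lunit2VK).
- exact: chcomps_lunit_nat.
- abstract (by move=> *; rewrite frE).
- abstract (by move=> *; rewrite frE).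
- abstract (by move=> *; rewrite cvE runit2K).
- abstract (by move=> *; rewrite cvE runit2VK).
- exact: chcomps_runit_nat.
- abstract (by move=> *; rewrite !chcomps_gg !cvE pentagon2).
- abstract (by move=> *; rewrite !chcomps_gg !cvE triangle2).
Defined.

(** [H^*] of [crossed] is [X]: objects, vertical and horizontal morphisms agree by
    definition, and [Glob] identifies the 2-cells of [X] with the globular squares
    of [crossed], compatibly with all operations. *)
Lemma Glob_globular a a' (A D : cell1 B a a') (t : cell2 A D) :
  @globular crossed a a' A D (Glob t).
Proof. by split; rewrite /= frE. Qed.

Inductive pval : forall a a' (A D : cell1 B a a'), presq A D -> cell2 A D -> Prop :=
| pval_glob a a' (A D : cell1 B a a') (t : cell2 A D) : pval (pglob t) t
| pval_tri a (A D : cell1 B a a) (dn : cell2 (id1 B a) D) (up : cell2 A (id1 B a)) :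
    pval (ptri dn (idm V a) up) (dn o2 up).

Lemma pval_rel a a' (A D : cell1 B a a') (x y : presq A D) :
  rel x y -> forall u, pval x u <-> pval y u.
Proof.
move=> h u; dependent destruction h.
- split=> h'; dependent destruction h'; rewrite -(slide_idm H).
  + rewrite -comp2_assoc; exact: pval_tri.
  + rewrite comp2_assoc; exact: pval_tri.
- split=> h'; dependent destruction h'; constructor.
Qed.

Lemma pval_clos a a' (A D : cell1 B a a') (x y : presq A D) :
  clos_refl_sym_trans _ (@rel _ _ _ _ A D) x y -> forall u, pval x u <-> pval y u.
Proof.
elim=> {x y} [x y h|x|x y _ IH|x y z _ IH _ IH'] u.
- exact: pval_rel.
- by [].
- by apply: iff_sym.
- by apply: iff_trans (IH u) (IH' u).
Qed.

Lemma Glob_inj a a' (A D : cell1 B a a') (s t : cell2 A D) : Glob s = Glob t -> s = t.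
Proof.
move=> e; have [h1 _] := pval_clos (cls_inj e) s.
have h2 := h1 (pval_glob s); by dependent destruction h2.
Qed.

Lemma Glob_surj a a' (A D : cell1 B a a') (p : csq A D) :
  @globular crossed a a' A D p -> exists t, p = Glob t.
Proof.
move=> [/= e _]; move: e; csq_dest p.
- by exists t.
- rewrite frE => e; subst; exists (dn o2 up); exact: Tri_id.
Qed.

End Crossed.

Section Induced.
Variable C : DoubleCategory.
Local Notation V := (vcat C).
Local Notation val := (@proj1_sig _ _).

Lemma usq_cancel_l (hC : fully_faithful C) (a b : ob C) (f : Hom V a b)
    (x y : glob_cell (hid a) (hid a)) : usq f oS val x = usq f oS val y -> x = y.
Proof.
case: x => x [xl xr]; case: y => y [yl yr] /= e; apply: glob_cell_eq => /=.
have [||z [_ hz]] := hC a b f _ _ _ (usq f oS x) (idm V a) (idm V a).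
- by rewrite lfr_comp xl.
- by rewrite rfr_comp xr.
- rewrite -(hz x (conj xl (conj xr eq_refl))).
  exact: hz y (conj yl (conj yr (eq_sym e))).
Qed.

Lemma usq_cancel_r (hC : absolutely_dense C) (a b : ob C) (f : Hom V a b)
    (x y : glob_cell (hid b) (hid b)) : val x oS usq f = val y oS usq f -> x = y.
Proof.
case: x => x [xl xr]; case: y => y [yl yr] /= e; apply: glob_cell_eq => /=.
have [||z [_ hz]] := hC a b f _ _ _ (x oS usq f) (idm V b) (idm V b).
- by rewrite lfr_comp xl.
- by rewrite rfr_comp xr.
- rewrite -(hz x (conj xl (conj xr eq_refl))).
  exact: hz y (conj yl (conj yr (eq_sym e))).
Qed.

Lemma opindexing_ex (hC : fully_faithful C) (a b : ob C) (f : Hom V a b)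
    (y : glob_cell (hid b) (hid b)) :
  exists x : glob_cell (hid a) (hid a), val y oS usq f = usq f oS val x.
Proof.
case: y => y [yl yr] /=.
have [||x [[xl [xr e]] _]] := hC a b f _ _ _ (y oS usq f) (idm V a) (idm V a).
- by rewrite lfr_comp yl lfr_usq comp_idl comp_idr.
- by rewrite rfr_comp yr rfr_usq comp_idl comp_idr.
- by exists (exist _ x (conj xl xr)).
Qed.

Lemma indexing_ex (hC : absolutely_dense C) (a b : ob C) (f : Hom V a b)
    (x : glob_cell (hid a) (hid a)) :
  exists y : glob_cell (hid b) (hid b), usq f oS val x = val y oS usq f.
Proof.
case: x => x [xl xr] /=.
have [||y [[yl [yr e]] _]] := hC a b f _ _ _ (usq f oS x) (idm V b) (idm V b).
- by rewrite lfr_comp xl lfr_usq comp_idl comp_idr.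
- by rewrite rfr_comp xr rfr_usq comp_idl comp_idr.
- by exists (exist _ y (conj yl yr)).
Qed.

Definition induced_op_map (hC : fully_faithful C) (a b : ob C) (f : Hom V a b)
    (y : glob_cell (hid b) (hid b)) : glob_cell (hid a) (hid a) := the (opindexing_ex hC f y).

Lemma induced_op_mapP (hC : fully_faithful C) (a b : ob C) (f : Hom V a b)
    (y : glob_cell (hid b) (hid b)) :
  val y oS usq f = usq f oS val (induced_op_map hC f y).
Proof. exact: (theP (opindexing_ex hC f y)). Qed.

Definition induced_ix_map (hC : absolutely_dense C) (a b : ob C) (f : Hom V a b)
    (x : glob_cell (hid a) (hid a)) : glob_cell (hid b) (hid b) := the (indexing_ex hC f x).

Lemma induced_ix_mapP (hC : absolutely_dense C) (a b : ob C) (f : Hom V a b)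
    (x : glob_cell (hid a) (hid a)) :
  usq f oS val x = val (induced_ix_map hC f x) oS usq f.
Proof. exact: (theP (indexing_ex hC f x)). Qed.

Lemma induced_op_one (hC : fully_faithful C) (a b : ob C) (f : Hom V a b) :
  induced_op_map hC f (HC_id2 _) = HC_id2 _.
Proof.
apply: (usq_cancel_l hC (f := f)).
by rewrite -induced_op_mapP /= vcomp_idl vcomp_idr.
Qed.

Lemma induced_op_mul (hC : fully_faithful C) (a b : ob C) (f : Hom V a b)
    (y x : glob_cell (hid b) (hid b)) :
  induced_op_map hC f (HC_comp2 y x)
  = HC_comp2 (induced_op_map hC f y) (induced_op_map hC f x).
Proof.
apply: (usq_cancel_l hC (f := f)).
rewrite -induced_op_mapP /= vcomp_assoc -induced_op_mapP -!vcomp_assoc.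
by rewrite -induced_op_mapP.
Qed.

Lemma induced_op_idm (hC : fully_faithful C) (a : ob C) (x : glob_cell (hid a) (hid a)) :
  induced_op_map hC (idm V a) x = x.
Proof.
apply: (usq_cancel_l hC (f := idm V a)).
by rewrite -induced_op_mapP usq_id vcomp_idl vcomp_idr.
Qed.

Lemma induced_op_comp (hC : fully_faithful C) (a b c : ob C)
    (g : Hom V b c) (f : Hom V a b) (x : glob_cell (hid c) (hid c)) :
  induced_op_map hC (g oV f) x = induced_op_map hC f (induced_op_map hC g x).
Proof.
apply: (usq_cancel_l hC (f := g oV f)).
rewrite -induced_op_mapP usq_comp vcomp_assoc (induced_op_mapP hC g).
by rewrite -!vcomp_assoc -induced_op_mapP.
Qed.

Lemma induced_ix_one (hC : absolutely_dense C) (a b : ob C) (f : Hom V a b) :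
  induced_ix_map hC f (HC_id2 _) = HC_id2 _.
Proof.
apply: (usq_cancel_r hC (f := f)).
by rewrite -induced_ix_mapP /= vcomp_idl vcomp_idr.
Qed.

Lemma induced_ix_mul (hC : absolutely_dense C) (a b : ob C) (f : Hom V a b)
    (y x : glob_cell (hid a) (hid a)) :
  induced_ix_map hC f (HC_comp2 y x)
  = HC_comp2 (induced_ix_map hC f y) (induced_ix_map hC f x).
Proof.
apply: (usq_cancel_r hC (f := f)).
rewrite -induced_ix_mapP /= vcomp_assoc induced_ix_mapP -!vcomp_assoc.
by rewrite induced_ix_mapP.
Qed.

Lemma induced_ix_idm (hC : absolutely_dense C) (a : ob C) (x : glob_cell (hid a) (hid a)) :
  induced_ix_map hC (idm V a) x = x.
Proof.
apply: (usq_cancel_r hC (f := idm V a)).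
by rewrite -induced_ix_mapP usq_id vcomp_idl vcomp_idr.
Qed.

Lemma induced_ix_comp (hC : absolutely_dense C) (a b c : ob C)
    (g : Hom V b c) (f : Hom V a b) (x : glob_cell (hid a) (hid a)) :
  induced_ix_map hC (g oV f) x = induced_ix_map hC g (induced_ix_map hC f x).
Proof.
apply: (usq_cancel_r hC (f := g oV f)).
rewrite -induced_ix_mapP usq_comp -vcomp_assoc (induced_ix_mapP hC f).
by rewrite !vcomp_assoc -induced_ix_mapP.
Qed.

Definition induced_opindexing (hC : fully_faithful C) : Opindexing (Hstar C).
Proof.
unshelve refine {| op_map := induced_op_map hC : forall a b : dob (Hstar C),
                     Hom (dver (Hstar C)) a b -> pi2 _ b -> pi2 _ a |}.
- exact: induced_op_one.
- exact: induced_op_mul.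
- exact: induced_op_idm.
- exact: induced_op_comp.
Defined.

Definition induced_indexing (hC : absolutely_dense C) : Indexing (Hstar C).
Proof.
unshelve refine {| ix_map := induced_ix_map hC : forall a b : dob (Hstar C),
                     Hom (dver (Hstar C)) a b -> pi2 _ a -> pi2 _ b |}.
- exact: induced_ix_one.
- exact: induced_ix_mul.
- exact: induced_ix_idm.
- exact: induced_ix_comp.
Defined.

End Induced.

Section Restriction.
Variables (C : DoubleCategory) (Phi : PiIndexing (Hstar C)).

(** [H^*F = id]: [F] is the identity on objects, vertical morphisms, horizontal
    morphisms and globular squares. *)
Definition Hstar_identity (F : StrictDoubleFunctor (crossed Phi) C) : Prop :=
  (forall a : ob C, fob F a = a) /\
  (forall (a b : ob C) (f : Hom (vcat C) a b), MkVMor (fver F f) = MkVMor f) /\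
  (forall (a b : ob C) (A : hor a b), MkHMor (fhor F A) = MkHMor A) /\
  (forall (a b : ob C) (A D : hor a b) (t : glob_cell A D),
     MkSquare (fsq F (@Glob (Hstar C) Phi a b A D t)) = MkSquare (proj1_sig t)).
End Restriction.

Definition full_on_globularly_generated (D C : DoubleCategory)
    (F : StrictDoubleFunctor D C) : Prop :=
  forall (a a' b b' : ob C) (A : hor a a') (B : hor b b') (p : sq A B),
    globularly_generated p ->
    exists (c c' d d' : ob D) (E : hor c c') (G : hor d d') (q : sq E G),
      MkSquare (fsq F q) = MkSquare p.

(* Main.v *)
Require Import Defs.
From Stdlib Require Import ssreflect.
From Stdlib Require Import ProofIrrelevance FunctionalExtensionality Program.Equality.

(** A triple [(dn, f, up)] of the crossed double category is a formal picture of the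
    square [dn o U_f o up], and every operation on triples is modelled on what this
    square does in [C]. So the functor sends a 2-cell to itself and a triple to the
    composite that it depicts. The only input from [C] is that the slides imposed on
    triples are true equations between squares ([slides_hold]), which is how the
    induced indexing is defined when unit squares are cartesian or opcartesian; from
    there on both cases are treated together.

    A slide makes evaluation well defined ([eval_pre_rel]) and also moves the loop
    in the middle of [dn' o U_g o up' o dn o U_f o up] past one of the two unit
    squares, so vertical composition is preserved ([eval_pvcomp]). Horizontal
    composition is preserved because of interchange and of the naturality of the left
    unitor, by which [U_f * U_f] is [U_f] up to the unitors ([hcomps_tri]).

    Uniqueness holds since [(dn, f, up)] is already the composite of [dn], [U_f] and
    [up] in the crossed double category ([Tri_vcomp]): its image is forced by
    functoriality and by the images of globular squares and of units.

    The image of the functor contains globular squares and unit squares, and is closed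
    under both compositions as the functor is strict; hence it contains every
    globularly generated square ([eval_surj]). Since a square in the image is globular
    or of the form [dn o U_f o up], this also proves that the length is one. *)

(** * Evaluation of triples *)

Section Evaluation.
#[local] Set Implicit Arguments.
#[local] Unset Strict Implicit.
Variables (C : DoubleCategory) (Phi : PiIndexing (Hstar C)).
Local Notation V := (vcat C).
Local Notation val := (@proj1_sig _ _).

(** The equation for which [slide] stands, read in [C]; it makes sense for both
    variances of the indexing. *)
Definition slides_hold : Prop :=
  forall (a b : ob C) (f : Hom V a b) (y : glob_cell (hid b) (hid b))
    (x : glob_cell (hid a) (hid a)),
    slide Phi f y x -> val y oS usq f = usq f oS val x.

Hypothesis hPhi : slides_hold.

Definition eval_pre (a a' b b' : ob C) (A : hor a a') (D : hor b b')
    (x : @presq (Hstar C) a a' b b' A D) : sq A D :=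
  match x in @presq _ a a' b b' A D return sq (A : hor a a') (D : hor b b') with
  | pglob t => val t
  | ptri dn f up => val dn oS usq f oS val up
  end.

Lemma eval_pre_rel (a a' b b' : ob C) (A : hor a a') (D : hor b b')
    (x y : @presq (Hstar C) a a' b b' A D) :
  rel Phi x y -> eval_pre x = eval_pre y.
Proof.
case=> {a a' b b' A D x y} /=.
- move=> a b A D dn f up y x /hPhi e.
  by rewrite -(vcomp_assoc _ (val y)) e !vcomp_assoc.
- by move=> a A D dn up; rewrite usq_id vcomp_idr.
Qed.

Lemma eval_pre_cls (a a' b b' : ob C) (A : hor a a') (D : hor b b')
    (x y : @presq (Hstar C) a a' b b' A D) :
  cls (@rel _ Phi _ _ _ _ A D) x = cls _ y -> eval_pre x = eval_pre y.
Proof.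
move=> e; elim: (cls_inj e) => {x y e}.
- exact: eval_pre_rel.
- by [].
- by move=> x y _ ->.
- by move=> x y z _ -> _ ->.
Qed.

Definition eval (a a' b b' : ob C) (A : hor a a') (D : hor b b')
    (p : @csq (Hstar C) Phi a a' b b' A D) : sq A D :=
  eval_pre (the (csq_case p)).

Lemma eval_cls (a a' b b' : ob C) (A : hor a a') (D : hor b b')
    (x : @presq (Hstar C) a a' b b' A D) :
  eval (cls (@rel _ Phi _ _ _ _ A D) x) = eval_pre x.
Proof. by apply: eval_pre_cls; rewrite -(theP (csq_case (cls _ x))). Qed.

Lemma eval_Glob (a a' : ob C) (A D : hor a a') (t : glob_cell A D) :
  eval (@Glob (Hstar C) Phi a a' A D t) = val t.
Proof. exact: eval_cls. Qed.

Lemma eval_Tri (a b : ob C) (A : hor a a) (D : hor b b)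
    (dn : glob_cell (hid b) D) (f : Hom V a b) (up : glob_cell A (hid a)) :
  eval (@Tri (Hstar C) Phi a b A D dn f up) = val dn oS usq f oS val up.
Proof. exact: eval_cls. Qed.

Lemma lfr_eval (a a' b b' : ob C) (A : hor a a') (D : hor b b')
    (p : @csq (Hstar C) Phi a a' b b' A D) : lfr (eval p) = clfr p.
Proof.
have [x ->] := csq_case p; rewrite eval_cls clfr_cls.
case: {p} x => {a a' b b' A D} [a a' A D [t [tl tr]] //|].
move=> a b A D [dn [dl dr]] f [up [ul ur]] /=.
by rewrite !lfr_comp lfr_usq dl ul comp_idl comp_idr.
Qed.

Lemma rfr_eval (a a' b b' : ob C) (A : hor a a') (D : hor b b')
    (p : @csq (Hstar C) Phi a a' b b' A D) : rfr (eval p) = crfr p.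
Proof.
have [x ->] := csq_case p; rewrite eval_cls crfr_cls.
case: {p} x => {a a' b b' A D} [a a' A D [t [tl tr]] //|].
move=> a b A D [dn [dl dr]] f [up [ul ur]] /=.
by rewrite !rfr_comp rfr_usq dr ur comp_idl comp_idr.
Qed.

(** For two triples the loop [up' o dn] between the two unit squares is moved up
    through [U_f], or down through [U_g], according to the variance. *)
Lemma eval_pvcomp (a a' b b' c c' : ob C)
    (A : hor a a') (D : hor b b') (E : hor c c')
    (x : @presq (Hstar C) a a' b b' A D) (y : @presq (Hstar C) b b' c c' D E)
    (z : @presq (Hstar C) a a' c c' A E) :
  pvcomp Phi x y z -> eval_pre z = eval_pre y oS eval_pre x.
Proof.
case=> {a a' b b' c c' A D E x y z} /=; try by move=> *; rewrite /= ?vcomp_assoc.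
move=> a b c A D E dn f up dn' g up'; rewrite /ptri_comp.
have := hPhi; rewrite /slides_hold /slide; case: Phi => P h /=.
- have /= e := h _ _ f (HC_comp2 up' dn) _ eq_refl.
  by rewrite usq_comp !vcomp_assoc -(vcomp_assoc _ (usq f)) -e !vcomp_assoc.
- have /= e := h _ _ g _ (HC_comp2 up' dn) eq_refl.
  by rewrite usq_comp !vcomp_assoc -(vcomp_assoc _ _ (usq g)) e !vcomp_assoc.
Qed.

Lemma eval_cvcomp (a a' b b' c c' : ob C)
    (A : hor a a') (D : hor b b') (E : hor c c')
    (q : @csq (Hstar C) Phi b b' c c' D E) (p : @csq (Hstar C) Phi a a' b b' A D) :
  eval (cvcomp q p) = eval q oS eval p.
Proof.
have [x ->] := csq_case p; have [y ->] := csq_case q.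
have [z h] := pvcomp_ex Phi x y.
by rewrite (cvcomp_cls h) !eval_cls (eval_pvcomp h).
Qed.

(** Naturality of the left unitor at [U_f], whose own left frame is [f]. *)
Lemma hcomps_usq (a b : ob C) (f : Hom V a b) (e : rfr (usq f) = lfr (usq f)) :
  hcomps (usq f) (usq f) e = lunit_inv (hid b) oS usq f oS lunit (hid a).
Proof.
have e' : rfr (usq (lfr (usq f))) = lfr (usq f) by rewrite rfr_usq.
rewrite -vcomp_assoc -(lunit_nat e') vcomp_assoc lunitK vcomp_idl.
by apply: hcomps_irr => //; rewrite lfr_usq.
Qed.

(** By interchange the three layers are composed horizontally one by one, and the
    unitors around [U_f] that come from the middle layer are absorbed into the outer
    ones. The right-hand side is the evaluation of the composite triple. *)
Lemma hcomps_tri (a b : ob C) (A A' : hor a a) (D D' : hor b b) (f : Hom V a b)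
    (dn : glob_cell (hid b) D) (up : glob_cell A (hid a))
    (dn' : glob_cell (hid b) D') (up' : glob_cell A' (hid a))
    (e : rfr (val dn oS usq f oS val up) = lfr (val dn' oS usq f oS val up')) :
  hcomps (val dn oS usq f oS val up) (val dn' oS usq f oS val up') e
  = (val (HC_hcomp2 dn dn') oS lunit_inv (hid b)) oS usq f
    oS (lunit (hid a) oS val (HC_hcomp2 up up')).
Proof.
have ef : rfr (usq f) = lfr (usq f) by rewrite rfr_usq lfr_usq.
have edn : rfr (val dn) = lfr (val dn') := glob_frames (proj2_sig dn) (proj2_sig dn').
have eup : rfr (val up) = lfr (val up') := glob_frames (proj2_sig up) (proj2_sig up').
have edf : rfr (val dn oS usq f) = lfr (val dn' oS usq f).
  by rewrite rfr_comp lfr_comp edn ef.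
rewrite (interchange e eup edf) (interchange edf ef edn) hcomps_usq.
rewrite !vcomp_assoc /=; congr (_ oS _ oS _ oS _ oS _); exact: hcomps_irr.
Qed.

Lemma eval_chcomps (a a' a'' b b' b'' : ob C)
    (A : hor a a') (A' : hor a' a'') (D : hor b b') (D' : hor b' b'')
    (p : @csq (Hstar C) Phi a a' b b' A D) (q : @csq (Hstar C) Phi a' a'' b' b'' A' D')
    (e : crfr p = clfr q) (e' : rfr (eval p) = lfr (eval q)) :
  eval (chcomps e) = hcomps (eval p) (eval q) e'.
Proof.
have [r [x [y [z [ep [eq [er h]]]]]]] := phcomp_ex e; subst.
rewrite (chcomps_cls e h) eval_cls.
move: e'; rewrite !eval_cls; case: h => {a a' a'' b b' b'' A A' D D' x y z e}.
- by move=> *; exact: hcomps_irr.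
- by move=> a b A A' D D' f dn up dn' up' e' /=; rewrite hcomps_tri.
Qed.

Definition eval_functor : StrictDoubleFunctor (crossed Phi) C.
Proof.
unshelve refine {|
  fob := fun a : ob (crossed Phi) => (a : ob C);
  fver := fun a b (f : Hom (vcat (crossed Phi)) a b) => (f : Hom V a b);
  fhor := fun a b (A : @hor (crossed Phi) a b) => (A : @hor C a b);
  fsq := eval
|} => //=.
- abstract (by move=> *; exact: eval_Glob).
- exact: eval_cvcomp.
- exact: lfr_eval.
- exact: rfr_eval.
- abstract (by move=> a b f; rewrite /cusq eval_Tri vcomp_idl vcomp_idr).
- abstract (by move=> *; rewrite eval_chcomps).
- abstract (by move=> *; rewrite eval_Glob).
- abstract (by move=> *; rewrite eval_Glob).
- abstract (by move=> *; rewrite eval_Glob).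
Defined.

End Evaluation.

(** * Uniqueness *)

Section Uniqueness.
#[local] Set Implicit Arguments.
#[local] Unset Strict Implicit.
Variable C : DoubleCategory.

Lemma MkVMor_inj (a b : ob C) (f g : Hom (vcat C) a b) : MkVMor f = MkVMor g -> f = g.
Proof. by move=> e; dependent destruction e. Qed.

Lemma MkHMor_inj (a b : ob C) (A D : @hor C a b) : MkHMor A = MkHMor D -> A = D.
Proof. by move=> e; dependent destruction e. Qed.

Lemma MkSquare_inj (a a' b b' : ob C) (A : hor a a') (D : hor b b') (p q : sq A D) :
  MkSquare p = MkSquare q -> p = q.
Proof. by move=> e; dependent destruction e. Qed.

Variable Phi : PiIndexing (Hstar C).

(** The unit square of [f] is the triple with identity 2-cells, so composing it with
    globular squares recovers every triple. *)
Lemma Tri_vcomp (a b : ob C) (A : hor a a) (D : hor b b)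
    (dn : glob_cell (hid b) D) (f : Hom (vcat C) a b) (up : glob_cell A (hid a)) :
  @Tri (Hstar C) Phi a b A D dn f up
  = @vcomp (crossed Phi) _ _ _ _ _ _ _ _ _
      (@vcomp (crossed Phi) _ _ _ _ _ _ _ _ _
         (@Glob (Hstar C) Phi b b _ _ dn) (@usq (crossed Phi) a b f))
      (@Glob (Hstar C) Phi a a _ _ up).
Proof.
by rewrite /= /cusq cvcomp_gt cvcomp_tg (@comp2_idr _ (HC C)) (@comp2_idl _ (HC C)).
Qed.

(** On a triple both functors are determined by [Tri_vcomp]; the remaining fields of
    the record are propositions. *)
Lemma Hstar_identity_unique (F G : StrictDoubleFunctor (crossed Phi) C) :
  Hstar_identity F -> Hstar_identity G -> F = G.
Proof.
case: F => oF vF hF sF ? ? ? cF ? ? ? uF ? ? ? ? ?.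
case: G => oG vG hG sG ? ? ? cG ? ? ? uG ? ? ? ? ?.
case=> /= eoF [evF [ehF egF]] [/= eoG [evG [ehG egG]]].
(* The identity on objects is substituted before the other components are compared,
   since their types depend on it. *)
have eo : oF = (fun a => a) by apply: functional_extensionality.
subst oF.
have eo : oG = (fun a => a) by apply: functional_extensionality.
subst oG.
have ev : vF = (fun _ _ f => f).
  by do 3 apply: functional_extensionality_dep => ?; apply: MkVMor_inj.
subst vF.
have ev : vG = (fun _ _ f => f).
  by do 3 apply: functional_extensionality_dep => ?; apply: MkVMor_inj.
subst vG.
have eh : hF = (fun _ _ A => A).
  by do 3 apply: functional_extensionality_dep => ?; apply: MkHMor_inj.
subst hF.
have eh : hG = (fun _ _ A => A).
  by do 3 apply: functional_extensionality_dep => ?; apply: MkHMor_inj.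
subst hG.
suff es : sF = sG by subst sG; f_equal; apply: proof_irrelevance.
do 6 apply: functional_extensionality_dep => ?.
apply: functional_extensionality_dep.
apply: (csq_elim (X := Hstar C)
  (P := fun a a' b b' A D p => sF a a' b b' A D p = sG a a' b b' A D p)).
- by move=> a a' A D t; apply: MkSquare_inj; rewrite egF egG.
- move=> a b A D dn f up.
  rewrite [Tri _ _ _ _]Tri_vcomp !cF !cG.
  rewrite (MkSquare_inj (uF a b f)) (MkSquare_inj (uG a b f)).
  by rewrite (MkSquare_inj (egF _ _ _ _ dn)) (MkSquare_inj (egF _ _ _ _ up))
       (MkSquare_inj (egG _ _ _ _ dn)) (MkSquare_inj (egG _ _ _ _ up)).
Qed.

End Uniqueness.

(** * Fullness and length *)

Section Fullness.
#[local] Set Implicit Arguments.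
#[local] Unset Strict Implicit.
Variables (C : DoubleCategory) (Phi : PiIndexing (Hstar C)).
Hypothesis hPhi : slides_hold Phi.

Lemma Hstar_identity_eval : Hstar_identity (eval_functor hPhi).
Proof. by do !split=> //; move=> *; rewrite /= eval_Glob. Qed.

(** The preimage has the same horizontal morphisms as [p], so vertically composable
    squares have composable preimages; as evaluation preserves frames, the same is
    true for horizontal composition. *)
Lemma eval_surj (a a' b b' : ob C) (A : hor a a') (D : hor b b') (p : sq A D) :
  globularly_generated p -> exists q : @csq (Hstar C) Phi a a' b b' A D, eval q = p.
Proof.
elim=> {a a' b b' A D p}.
- move=> a a' A D p hp.
  exists (@Glob (Hstar C) Phi a a' A D (exist _ p hp)); exact: eval_Glob.
- move=> a b f; exists (@usq (crossed Phi) a b f).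
  exact: MkSquare_inj (fsq_usq (eval_functor hPhi) f).
- move=> a a' b b' c c' A D E q p _ [y <-] _ [x <-].
  by exists (cvcomp y x); rewrite eval_cvcomp.
- move=> a a' a'' b b' b'' A A' D D' p q e _ [x ep] _ [y eq]; subst.
  have exy : crfr x = clfr y by rewrite -(rfr_eval hPhi) -(lfr_eval hPhi).
  by exists (chcomps exy); apply: eval_chcomps.
Qed.

Lemma eval_functor_full : full_on_globularly_generated (eval_functor hPhi).
Proof.
move=> a a' b b' A D p /eval_surj [q e].
by exists a, a', b, b', A, D, q; rewrite /= e.
Qed.

Lemma vertically_generated_eval (a a' b b' : ob C) (A : hor a a') (D : hor b b')
    (q : @csq (Hstar C) Phi a a' b b' A D) : vertically_generated (eval q).
Proof.
elim/(@csq_elim (Hstar C)): q => {a a' b b' A D}.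
- by move=> a a' A D [t ht]; rewrite (eval_Glob hPhi); apply: vg_glob.
- move=> a b A D [dn hdn] f [up hup]; rewrite (eval_Tri hPhi) /=.
  by apply: vg_vcomp; [apply: vg_vcomp; [exact: vg_glob|exact: vg_unit]|exact: vg_glob].
Qed.

Lemma length_one_of_indexing : length_one C.
Proof. by move=> a a' b b' A D p /eval_surj [q <-]; apply: vertically_generated_eval. Qed.

Lemma unique_full_functor :
  exists F : StrictDoubleFunctor (crossed Phi) C,
    unique (@Hstar_identity C Phi) F /\ full_on_globularly_generated F.
Proof.
exists (eval_functor hPhi); split; last exact: eval_functor_full.
split; first exact: Hstar_identity_eval.
by move=> G; apply: Hstar_identity_unique Hstar_identity_eval.
Qed.

End Fullness.

Lemma induced_opindexing_slides_hold {C : DoubleCategory} (hC : fully_faithful C) :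
  slides_hold (OpInd (induced_opindexing hC)).
Proof. by move=> a b f y x ->; apply: induced_op_mapP. Qed.

Lemma induced_indexing_slides_hold {C : DoubleCategory} (hC : absolutely_dense C) :
  slides_hold (Ind (induced_indexing hC)).
Proof. by move=> a b f y x ->; rewrite [RHS]induced_ix_mapP. Qed.

Theorem theorem5p2 (C : FramedBicategory) :
  (fully_faithful C \/ absolutely_dense C -> length_one C)
  /\
  (forall hC : fully_faithful C,
    exists F : StrictDoubleFunctor (crossed (OpInd (induced_opindexing hC))) C,
      unique (@Hstar_identity C _) F /\ full_on_globularly_generated F)
  /\
  (forall hC : absolutely_dense C,
    exists F : StrictDoubleFunctor (crossed (Ind (induced_indexing hC))) C,
      unique (@Hstar_identity C _) F /\ full_on_globularly_generated F).
Proof.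
split; last split.
- case=> hC.
  + exact: (length_one_of_indexing (induced_opindexing_slides_hold hC)).
  + exact: (length_one_of_indexing (induced_indexing_slides_hold hC)).
- by move=> hC; exact: (unique_full_functor (induced_opindexing_slides_hold hC)).
- by move=> hC; exact: (unique_full_functor (induced_indexing_slides_hold hC)).
Qed.
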